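(* Let $\mathscr{E}$ be a Hilbert module over the $C^*$-algebra $\mathcal{A}$, and let $s,t\in\mathcal{L}(\mathscr{E})$. The following conditions are equivalent: (i) $\|s+t\|=\|s\|+\|t\|$. (ii) There exist sequences $(\varphi_n)_{n\ge 0}$ (of states on $\mathcal{A}$) and $(x_n)_{n\ge 0}$ (of elements in $\mathscr{E}$) such that $\varphi_n(|x_n|^2)=1$ for all $n\ge 0$ and $\varphi_n(\langle sx_n,tx_n\rangle)\to\|s\|\|t\|$ as $n\to\infty$. (iii) There exist sequences $(\varphi_n)_{n\ge 0}$ (of states on $\mathcal{A}$) and $(x_n)_{n\ge 0}$ (of elements in $\mathscr{E}$) such that $\varphi_n(|x_n|^2)\le 1$ for all $n\ge 0$ and $\varphi_n(\langle sx_n,tx_n\rangle)\to\|s\|\|t\|$ as $n\to\infty$.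
   Context: A (right) Hilbert $\mathcal{A}$-module $\mathscr{E}$ is a complex linear space that is a right $\mathcal{A}$-module with compatible scalar multiplication, equipped with an $\mathcal{A}$-valued inner product, i.e. a sesquilinear map $\langle\cdot,\cdot\rangle:\mathscr{E}\times\mathscr{E}\to\mathcal{A}$ (conjugate-linear in the first and linear in the second variable) such that $\langle x,x\rangle\ge 0$ with $\langle x,x\rangle=0$ if and only if $x=0$, $\langle x,y\rangle^*=\langle y,x\rangle$, and $\langle x,ya\rangle=\langle x,y\rangle a$ for $x,y\in\mathscr{E}$, $a\in\mathcal{A}$, and which is complete in the norm $\|x\|:=\||x|\|_{\mathcal{A}}$, where $|x|:=\langle x,x\rangle^{1/2}$. $\mathcal{L}(\mathscr{E})$ is the $C^*$-algebra of adjointable operators on $\mathscr{E}$, i.e. maps $T:\mathscr{E}\to\mathscr{E}$ for which there is a map $T^*:\mathscr{E}\to\mathscr{E}$ with $\langle Tx,y\rangle=\langle x,T^*y\rangle$ for all $x,y\in\mathscr{E}$, with the operator norm.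
   Formalization: The Hilbert module is assumed nonzero: for the zero module, condition (i) holds trivially while condition (ii) fails because |x|^2 = 0 for every x, so the equivalence is false there. *)

(* Defs.v *)
From HB Require Import structures.
From mathcomp Require Import all_boot all_order all_algebra.
From mathcomp Require Import complex.
From mathcomp Require Import all_classical all_reals all_analysis.

Set Implicit Arguments.
Unset Strict Implicit.
Unset Printing Implicit Defensive.
Import Order.TTheory GRing.Theory Num.Theory.
Import numFieldNormedType.Exports.
Local Open Scope classical_set_scope.
Local Open Scope ring_scope.
Local Open Scope complex_scope.

(* A C*-algebra is not assumed to have a unit, so its product cannot come from
   the ring structures of MathComp, which are all unital.  The norm takes its
   values in [R[i]], as in every [normedModType R[i]]. *)
HB.mixin Record isCStarAlgebra (R : realType) A
    of CompleteNormedModule R[i] A := {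
  cmul : A -> A -> A ;
  cstar : A -> A ;
  cmulA : forall a b c, cmul a (cmul b c) = cmul (cmul a b) c ;
  cmulDl : forall a b c, cmul (a + b) c = cmul a c + cmul b c ;
  cmulDr : forall a b c, cmul a (b + c) = cmul a b + cmul a c ;
  cmulZl : forall (k : R[i]) a b, cmul (k *: a) b = k *: cmul a b ;
  cmulZr : forall (k : R[i]) a b, cmul a (k *: b) = k *: cmul a b ;
  cstarK : forall a, cstar (cstar a) = a ;
  cstarD : forall a b, cstar (a + b) = cstar a + cstar b ;
  cstarZ : forall (k : R[i]) a, cstar (k *: a) = Num.conj k *: cstar a ;
  cstarM : forall a b, cstar (cmul a b) = cmul (cstar b) (cstar a) ;
  norm_cmul_le : forall a b, `|cmul a b| <= `|a| * `|b| ;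
  norm_cstar_cmul : forall a, `|cmul (cstar a) a| = `|a| ^+ 2 }.

#[short(type="cstarAlgType")]
HB.structure Definition CStarAlgebra (R : realType) :=
  { A of isCStarAlgebra R A & CompleteNormedModule R[i] A }.

(* Positivity in [A]: the elements of the form [b^* b]. *)
Definition cpos (R : realType) (A : cstarAlgType R) (a : A) : Prop :=
  exists b : A, a = cmul (cstar b) b.

(* The positive square root of a positive element; junk value on the other
   elements. *)
Definition csqrt (R : realType) (A : cstarAlgType R) (a : A) : A :=
  xget 0 [set b : A | cpos b /\ cmul b b = a].

(* Sesquilinearity of [inner] is [innerDr], [innerZr] together with
   [inner_conj]; additivity and conjugate-linearity in the first variable are
   consequences. *)
HB.mixin Record isHilbertModule (R : realType) (A : cstarAlgType R) E
    of CompleteNormedModule R[i] E := {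
  hact : E -> A -> E ;
  inner : E -> E -> A ;
  hactDl : forall x y a, hact (x + y) a = hact x a + hact y a ;
  hactDr : forall x a b, hact x (a + b) = hact x a + hact x b ;
  hactA : forall x a b, hact x (cmul a b) = hact (hact x a) b ;
  hactZl : forall (k : R[i]) x a, hact (k *: x) a = k *: hact x a ;
  hactZr : forall (k : R[i]) x a, hact x (k *: a) = k *: hact x a ;
  innerDr : forall x y z, inner x (y + z) = inner x y + inner x z ;
  innerZr : forall (k : R[i]) x y, inner x (k *: y) = k *: inner x y ;
  inner_conj : forall x y, cstar (inner x y) = inner y x ;
  inner_act : forall x y a, inner x (hact y a) = cmul (inner x y) a ;
  inner_pos : forall x, cpos (inner x x) ;
  inner_def : forall x, inner x x = 0 <-> x = 0 ;
  norm_hilbert : forall x, `|x| = `|csqrt (inner x x)| }.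

#[short(type="hilbertModType")]
HB.structure Definition HilbertModule (R : realType) (A : cstarAlgType R) :=
  { E of isHilbertModule R A E & CompleteNormedModule R[i] E }.

(* [habs x] is |x| = <x, x>^(1/2), so [norm_hilbert] reads ||x|| = || |x| ||. *)
Definition habs (R : realType) (A : cstarAlgType R) (E : hilbertModType A)
  (x : E) : A := csqrt (inner x x).

Definition adjointable (R : realType) (A : cstarAlgType R)
    (E : hilbertModType A) (T : E -> E) : Prop :=
  exists T' : E -> E, forall x y : E, inner (T x) y = inner x (T' y) :> A.

(* [sup] is 0 on an unbounded set, so this is the operator norm only for
   bounded linear maps; adjointable operators and positive linear functionals
   are automatically bounded. *)
Definition opnorm (R : realType) (V W : normedModType R[i]) (f : V -> W) : R :=
  sup [set complex.Re `|f x| | x in [set x : V | `|x| <= 1]].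

(* States are the positive linear functionals of norm 1 (for unital [A] this is
   the normalisation phi(1) = 1).  The order of [R[i]] makes [0 <= z] say that
   [z] is real and nonnegative. *)
Definition state (R : realType) (A : cstarAlgType R) (phi : {scalar A}) : Prop :=
  (forall a : A, cpos a -> 0 <= phi a) /\
  opnorm (phi : A -> R[i]^o) = 1.

(* Main.v *)
(* The heart of the matter is a supply of states: for every b <> 0 in A there is a
   state phi with phi (b^* b) = |b|^2.  Embed A in its unitization U, normed as an
   algebra of operators on A, and call a functional on U normalized when it has norm
   1 and maps 1 to 1.  Such a functional phi is real on selfadjoint elements, and
   expanding (1 + i s k)^(2m) gives phi (k^2) >= 0.  Repeated squaring of the
   Cauchy-Schwarz inequality then gives phi (g (1 - a) g) >= 0 for commuting
   selfadjoint g and a with |a| <= 1, and two such cubic inequalities bootstrap to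
   phi (b^* b) >= 0 for every b.  Normalized functionals attaining the norm of a
   selfadjoint k come from Hahn-Banach, as |1 + k| or |1 - k| equals 1 + |k|:
   otherwise the coefficients of the polynomial (l + z k)^N would be too small on
   the unit circle.

   For a state phi, the form phi <x, y> is positive semidefinite, and repeated
   squaring gives phi <T x, T x> <= |T|^2 phi <x, x> for adjointable T; boundedness
   of T comes from a gliding hump.  The equivalence follows by expanding
   phi <(s + t) x, (s + t) x> at vectors x almost attaining |s + t|, with phi
   norming (s + t) x. *)
Require Import Defs.
From HB Require Import structures.
From mathcomp Require Import all_boot all_order all_algebra.
From mathcomp Require Import complex.
From mathcomp Require Import all_classical all_reals all_analysis.
From mathcomp Require Import ring lra zify.

Set Implicit Arguments.
Unset Strict Implicit.
Unset Printing Implicit Defensive.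
Import Order.TTheory GRing.Theory Num.Theory.
Import numFieldNormedType.Exports.
Local Open Scope classical_set_scope.
Local Open Scope ring_scope.
Local Open Scope complex_scope.

(** * The complex-valued norm, read in [R] *)

Definition rnorm (R : realType) (V : normedZmodType R[i]) (x : V) : R :=
  complex.Re `|x|.

Section RealNorm.
Variable R : realType.
Implicit Types (V : normedZmodType R[i]) (W : normedModType R[i]) (z w : R[i]).

Lemma rnormE V (x : V) : `|x| = (rnorm x)%:C.
Proof. by rewrite /rnorm RRe_real ?normr_real. Qed.

Lemma rnorm_ge0 V (x : V) : 0 <= rnorm x.
Proof. by rewrite -ler0c -rnormE. Qed.

Lemma rnormD V (x y : V) : rnorm (x + y) <= rnorm x + rnorm y.
Proof. by rewrite -lecR rmorphD/= -!rnormE ler_normD. Qed.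

Lemma rnormN V (x : V) : rnorm (- x) = rnorm x.
Proof. by rewrite /rnorm normrN. Qed.

Lemma rnorm0 V : rnorm (0 : V) = 0.
Proof. by rewrite /rnorm normr0. Qed.

Lemma rnorm0_eq0 V (x : V) : rnorm x = 0 -> x = 0.
Proof. by move=> x0; apply/eqP; rewrite -normr_eq0 rnormE x0. Qed.

Lemma rnorm_gt0 V (x : V) : x != 0 -> 0 < rnorm x.
Proof.
move=> x0; rewrite lt_neqAle rnorm_ge0 andbT eq_sym.
by apply: contra x0 => /eqP/rnorm0_eq0/eqP.
Qed.

Lemma rnormM z w : rnorm (z * w) = rnorm z * rnorm w.
Proof. by apply: complexI; rewrite rmorphM/= -!rnormE normrM. Qed.

Lemma rnormZ W z (x : W) : rnorm (z *: x) = rnorm z * rnorm x.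
Proof. by apply: complexI; rewrite rmorphM/= -!rnormE normrZ. Qed.

Lemma rnormC (x : R) : rnorm x%:C = `|x|.
Proof. by rewrite /rnorm normc_def/= expr0n/= addr0 sqrtr_sqr. Qed.

Lemma rnorm1 : rnorm (1 : R[i]) = 1.
Proof. by rewrite /rnorm normr1. Qed.

Lemma rnorm_i : rnorm ('i : R[i]) = 1.
Proof. by rewrite /rnorm normc_def/= expr0n/= expr1n add0r sqrtr1. Qed.

Lemma rnormX z n : rnorm (z ^+ n) = rnorm z ^+ n.
Proof. by elim: n => [|n IH]; rewrite ?rnorm1 // !exprS rnormM IH. Qed.

Lemma rnorm_conj z : rnorm (Num.conj z) = rnorm z.
Proof. by rewrite /rnorm norm_conjC. Qed.

Lemma sqr_rnorm z : rnorm z ^+ 2 = complex.Re z ^+ 2 + complex.Im z ^+ 2.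
Proof. by apply: complexI; rewrite rmorphXn/= -rnormE add_Re2_Im2. Qed.

Lemma conj_mul z : Num.conj z * z = (rnorm z ^+ 2)%:C.
Proof. by rewrite mulrC -sqr_normc rnormE -rmorphXn. Qed.

Lemma ler_Re z : complex.Re z <= rnorm z.
Proof.
rewrite (le_trans (ler_norm _))// -(@ler_pXn2r _ 2) ?nnegrE ?rnorm_ge0//.
by rewrite sqr_rnorm real_normK ?num_real// lerDl sqr_ge0.
Qed.

Lemma ReD z w : complex.Re (z + w) = complex.Re z + complex.Re w.
Proof. by case: z; case: w. Qed.

Lemma ReZ (t : R) z : complex.Re (t%:C * z) = t * complex.Re z.
Proof. by case: z => a b /=; rewrite mul0r subr0. Qed.

(** Absorbing the phase [w] into a vector turns bounds on the real part of a functional or form into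
    bounds on its modulus. *)
Lemma rotate z : exists2 w, rnorm w = 1 & complex.Re (w * z) = rnorm z.
Proof.
have [->|z0] := eqVneq z 0; first by exists 1; rewrite ?rnorm1 // mulr0 rnorm0.
have z1 : rnorm z != 0 by rewrite gt_eqF// rnorm_gt0.
exists ((rnorm z)%:C^-1 * Num.conj z).
  by rewrite rnormM rnorm_conj -fmorphV rnormC normfV ger0_norm ?rnorm_ge0// mulVf.
by rewrite -mulrA conj_mul -fmorphV -rmorphM/= expr2 mulKf.
Qed.

End RealNorm.

(** * The Hahn-Banach theorem for real functionals *)

Section HahnBanach.
Variables (R : realType) (V : lmodType R[i]).
Implicit Types (p q : V -> R).

(** Homogeneity concerns nonnegative real scalars only: the complex space is treated as a real
    one. *)
Definition sublinear p : Prop :=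
  (forall x y, p (x + y) <= p x + p y) /\
  (forall (t : R) x, 0 <= t -> p (t%:C *: x) = t * p x).

Lemma sublinear0 p : sublinear p -> p 0 = 0.
Proof. by move=> [_ pZ]; rewrite -(scale0r (0 : V)) pZ// mul0r. Qed.

Lemma sublinear_opp p x : sublinear p -> - p (- x) <= p x.
Proof.
move=> sp; rewrite -subr_ge0 opprK -(sublinear0 sp) -(subrr x).
by case: sp => pD _; exact: pD.
Qed.

(** For sublinear [p], this lowers [p] to a sublinear functional whose value at [- x0] is at most
    [- p x0]. A minimal sublinear functional is fixed by it for every [x0]. *)
Definition push p (x0 : V) (x : V) : R :=
  inf [set p (x + t%:C *: x0) - t * p x0 | t in [set t : R | 0 <= t]].

Lemma push_lb p x0 x : sublinear p ->
  lbound [set p (x + t%:C *: x0) - t * p x0 | t in [set t : R | 0 <= t]] (- p (- x)).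
Proof.
move=> [pD pZ] _ [t t0 <-]; rewrite -pZ//.
have := pD (x + t%:C *: x0) (- x); rewrite addrAC subrr add0r; lra.
Qed.

Lemma push_le_at p x0 x t : sublinear p -> 0 <= t ->
  push p x0 x <= p (x + t%:C *: x0) - t * p x0.
Proof.
move=> sp t0; apply: ge_inf; last by exists t.
by exists (- p (- x)); exact: push_lb.
Qed.

Lemma push_le p x0 x : sublinear p -> push p x0 x <= p x.
Proof.
move=> sp; apply: (le_trans (push_le_at x0 x sp (lexx 0))).
by rewrite scale0r addr0 mul0r subr0.
Qed.

Lemma push_ge p x0 x c : (forall t, 0 <= t -> c <= p (x + t%:C *: x0) - t * p x0) ->
  c <= push p x0 x.
Proof.
move=> H; apply: lb_le_inf; last by move=> _ [t t0 <-]; exact: H.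
by exists (p (x + 0%:C *: x0) - 0 * p x0); exists 0 => /=.
Qed.

Lemma push_approx p x0 x e : sublinear p -> 0 < e ->
  exists2 t, 0 <= t & p (x + t%:C *: x0) - t * p x0 < push p x0 x + e.
Proof.
move=> sp e0.
have [|_ [t t0 <-] lt] := @inf_adherent _
    [set p (x + t%:C *: x0) - t * p x0 | t in [set t : R | 0 <= t]] _ e0.
  split; last by exists (- p (- x)); exact: push_lb.
  by exists (p (x + 0%:C *: x0) - 0 * p x0); exists 0 => /=.
by exists t.
Qed.

Lemma sublinear_push p x0 : sublinear p -> sublinear (push p x0).
Proof.
move=> sp; have [pD pZ] := sp; split => [x y|t x t0].
  apply/ler_addgt0Pr => e e0.
  have e2 : 0 < e / 2 by lra.
  have [a a0 Ha] := push_approx x0 x sp e2.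
  have [b b0 Hb] := push_approx x0 y sp e2.
  have := push_le_at x0 (x + y) sp (addr_ge0 a0 b0).
  have -> : x + y + (a + b)%:C *: x0 = (x + a%:C *: x0) + (y + b%:C *: x0).
    by rewrite rmorphD scalerDl addrACA.
  have := pD (x + a%:C *: x0) (y + b%:C *: x0); nra.
(* One inequality is enough: the other is the same one for [t^-1]. *)
have key (c : R) z : 0 < c -> push p x0 (c%:C *: z) <= c * push p x0 z.
  move=> c0; apply/ler_addgt0Pr => e e0.
  have ec : 0 < e / c by rewrite divr_gt0.
  have [a a0 Ha] := push_approx x0 z sp ec.
  have ca : 0 <= c * a by rewrite mulr_ge0// ltW.
  apply: (le_trans (push_le_at x0 _ sp ca)).
  rewrite rmorphM -scalerA -scalerDr pZ ?(ltW c0)// -mulrA -mulrBr.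
  by rewrite -[X in _ <= _ + X](divfK (lt0r_neq0 c0)) [e / c * c]mulrC -mulrDr ler_pM2l// ltW.
move: t0; rewrite le_eqVlt => /orP[/eqP <-|t0].
  rewrite scale0r mul0r; apply/eqP; rewrite eq_le.
  rewrite (le_trans (push_le x0 0 sp)) ?(sublinear0 sp)//=.
  apply: push_ge => s s0; rewrite add0r pZ//; lra.
apply/eqP; rewrite eq_le key//=.
have t'0 : 0 < t^-1 by rewrite invr_gt0.
have := key t^-1 (t%:C *: x) t'0.
rewrite scalerA -rmorphM/= mulVf ?gt_eqF// scale1r mulrC ler_pdivlMr//.
by rewrite mulrC.
Qed.

Definition real_linear (f : V -> R) : Prop :=
  (forall x y, f (x + y) = f x + f y) /\ (forall (t : R) x, f (t%:C *: x) = t * f x).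

(** Minimality gives [push q y = q], and the term [t = 1] of that infimum yields
    [q x <= q (x + y) - q y], the missing half of additivity. *)
Lemma minimal_real_linear q : sublinear q ->
  (forall q', sublinear q' -> (forall x, q' x <= q x) -> q' = q) -> real_linear q.
Proof.
move=> sq qmin; have [qD qZ] := sq.
have add x y : q (x + y) = q x + q y.
  apply/eqP; rewrite eq_le qD/= -lerBrDr.
  rewrite -{1}(qmin _ (sublinear_push y sq) (fun z => push_le y z sq)).
  by have := push_le_at y x sq ler01; rewrite scale1r mul1r.
have opp x : q (- x) = - q x.
  by apply/eqP; rewrite -addr_eq0 -add addNr (sublinear0 sq).
split=> // t x; have [t0|t0] := leP 0 t; first exact: qZ.
rewrite -[t]opprK rmorphN scaleNr opp qZ ?oppr_ge0 ?(ltW t0)//.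
ring.
Qed.

Lemma minimal_sublinear p : sublinear p ->
  exists q, [/\ sublinear q, forall x, q x <= p x &
    forall q', sublinear q' -> (forall x, q' x <= q x) -> q' = q].
Proof.
move=> sp.
pose T := {q : V -> R | sublinear q /\ forall x, q x <= p x}.
(* Zorn's lemma produces maximal elements, so the pointwise order is reversed. *)
pose r (a b : T) := `[< forall x, sval b x <= sval a x >].
have [|||A Atot|[q [sq qp]] qmin] := @Zorn T r.
- by move=> a; apply/asboolP.
- move=> a b c /asboolP ab /asboolP bc; apply/asboolP => x.
  exact: le_trans (bc x) (ab x).
- move=> [a Ha] [b Hb] /asboolP ab /asboolP ba; apply: eq_exist => /=.
  by apply/funext => x; apply/eqP; rewrite eq_le ab ba.
- have [A0|/set0P[a0 Aa0]] := eqVneq A set0.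
    by exists (exist _ p (conj sp (fun x => lexx _))) => s; rewrite A0.
  pose F x := [set sval a x | a in A].
  have lbF x : lbound (F x) (- p (- x)).
    move=> _ [[a [sa ap]] _ <-] /=; rewrite lerNl; apply: le_trans (ap _).
    by rewrite lerNl; exact: sublinear_opp.
  have hF x : has_inf (F x).
    by split; [exists (sval a0 x); exists a0 | exists (- p (- x))].
  pose m x := inf (F x).
  have mle x a : A a -> m x <= sval a x.
    by move=> Aa; apply: ge_inf; [case: (hF x) | exists a].
  have mge x c : (forall a, A a -> c <= sval a x) -> c <= m x.
    move=> H; apply: lb_le_inf; first by case: (hF x).
    by move=> _ [a Aa <-]; exact: H.
  have sm : sublinear m.
    split=> [x y|t x t0].
      apply/ler_addgt0Pr => e e0.
      have e2 : 0 < e / 2 by lra.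
      have [_ [a Aa <-] Ha] := inf_adherent e2 (hF x).
      have [_ [b Ab <-] Hb] := inf_adherent e2 (hF y).
      (* Near-minimizers at [x] and [y] may be different members of the chain; the smaller one
         serves both points. *)
      have [ab|ba] := Atot a b Aa Ab.
        move/asboolP: ab => /(_ x) ab; have := mle (x + y) b Ab.
        have := (svalP b).1.1 x y; rewrite -/(m x) -/(m y) in Ha Hb *; lra.
      move/asboolP: ba => /(_ y) ba; have := mle (x + y) a Aa.
      have := (svalP a).1.1 x y; rewrite -/(m x) -/(m y) in Ha Hb *; lra.
    move: t0; rewrite le_eqVlt => /orP[/eqP <-|t0].
      rewrite scale0r mul0r; apply/eqP; rewrite eq_le (le_trans (mle _ _ Aa0))/=.
        by apply: mge => a _; rewrite (sublinear0 (svalP a).1).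
      by rewrite (sublinear0 (svalP a0).1).
    apply/eqP; rewrite eq_le; apply/andP; split.
      rewrite -ler_pdivrMl//; apply: mge => a Aa.
      by rewrite ler_pdivrMl// -(svalP a).1.2 ?(ltW t0)//; exact: mle.
    by apply: mge => a Aa; rewrite (svalP a).1.2 ?(ltW t0)// ler_pM2l//; exact: mle.
  have mp x : m x <= p x by apply: le_trans (mle x _ Aa0) ((svalP a0).2 x).
  by exists (exist _ m (conj sm mp)) => a Aa; apply/asboolP => x /=; exact: mle.
exists q; split=> // q' sq' q'q.
have q'p x : q' x <= p x := le_trans (q'q x) (qp x).
by have /(congr1 sval) := qmin (exist _ q' (conj sq' q'p)) (asboolT q'q).
Qed.

(** Minimizing below [push p x0] instead of [p] ensures [f (- x0) <= - p x0], which linearity turns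
    into [p x0 <= f x0]. *)
Lemma hahn_banach_attained p x0 : sublinear p ->
  exists f, [/\ real_linear f, forall x, f x <= p x & f x0 = p x0].
Proof.
move=> sp; have [q [sq qp qmin]] := minimal_sublinear (sublinear_push x0 sp).
have lq := minimal_real_linear sq qmin.
have qle x : q x <= p x := le_trans (qp x) (push_le x0 x sp).
exists q; split=> //; apply/eqP; rewrite eq_le qle/=.
have := le_trans (qp (- x0)) (push_le_at x0 (- x0) sp ler01).
rewrite scale1r addNr (sublinear0 sp) mul1r sub0r.
by have := lq.2 (-1) x0; rewrite rmorphN scaleN1r => ->; lra.
Qed.

End HahnBanach.

(** * Growth estimates over the reals *)

Section RealLemmas.
Variable R : realType.

Lemma bernoulli_ge (d : R) n : 0 <= d -> 1 + n%:R * d <= (1 + d) ^+ n.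
Proof.
move=> d0; elim: n => [|n IH]; first by rewrite mul0r addr0 expr0.
rewrite exprS -natr1; have := ler0n R n; have : 0 <= (n%:R : R) * d * d by rewrite !mulr_ge0.
nra.
Qed.

Lemma unbounded_nat (c d : R) : 0 < d -> (forall n : nat, n%:R * d <= c) -> False.
Proof.
move=> d0 H; have c0 : 0 <= c by have := H 0%N; rewrite mul0r.
have := archi_boundP (divr_ge0 c0 (ltW d0)); rewrite ltr_pdivrMr// => lt.
by have := lt_le_trans lt (H _); rewrite ltxx.
Qed.

(** If [r / K = 1 + d] with [d > 0], squaring Bernoulli's inequality gives [(2^n d)^2 <= 2^(n+1) c],
    hence [2^n d^2 <= 2 c] for all [n]. *)
Lemma exprn2_growth (r K c : R) : 0 <= r -> 0 <= K ->
  (forall j, r ^+ (2 ^ j) <= (2 ^ j)%:R * c * K ^+ (2 ^ j)) -> r <= K.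
Proof.
move=> r0 K0 H; rewrite leNgt; apply/negP => Kr.
have [K00|Kpos] : K = 0 \/ 0 < K by move: K0; rewrite le_eqVlt => /orP[/eqP|]; auto.
  by have := H 0%N; rewrite K00 expn0 !expr1 mulr0; rewrite K00 in Kr; lra.
pose d := r / K - 1.
have d0 : 0 < d by rewrite subr_gt0 ltr_pdivlMr// mul1r.
have rK : r = (1 + d) * K by rewrite /d addrC subrK divfK// gt_eqF.
have {}H j : (1 + d) ^+ (2 ^ j) <= (2 ^ j)%:R * c.
  by have := H j; rewrite rK exprMn ler_pM2r// exprn_gt0.
apply: (@unbounded_nat (2 * c) (d ^+ 2)); first exact: exprn_gt0.
move=> n; have n2 : (n%:R : R) <= (2 ^ n)%:R by rewrite ler_nat ltnW// ltn_expl.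
apply: le_trans (_ : (2 ^ n)%:R * d ^+ 2 <= _); first by rewrite ler_wpM2r ?sqr_ge0.
have p0 : (0 : R) < (2 ^ n)%:R by rewrite ltr0n expn_gt0.
have := H n.+1; rewrite expnSr exprM natrM.
have b := bernoulli_ge (2 ^ n) (ltW d0).
have b2 : ((2 ^ n)%:R * d) ^+ 2 <= ((1 + d) ^+ (2 ^ n)) ^+ 2.
  rewrite ler_pXn2r ?nnegrE ?mulr_ge0 ?exprn_ge0 ?ltW//; lra.
move=> /(le_trans b2); rewrite -(ler_pM2l p0).
rewrite exprMn [_%:R ^+ 2]expr2 -!mulrA ler_pM2l// => ?; nra.
Qed.

Lemma le_of_le_add_small (a b c s0 : R) : 0 < s0 ->
  (forall s, 0 < s -> s <= s0 -> a <= b + s * c) -> a <= b.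
Proof.
move=> s00 H; apply/ler_addgt0Pr => e e0.
pose s := Num.min s0 (e / (`|c| + 1)).
have c1 : 0 < `|c| + 1 by rewrite ltr_wpDl.
have s_gt0 : 0 < s by rewrite lt_min s00 divr_gt0.
have sm : s <= s0 by rewrite ge_min lexx.
apply: le_trans (H s s_gt0 sm) _; rewrite lerD2l.
have : s * (`|c| + 1) <= e by rewrite -ler_pdivlMr// ge_min lexx orbT.
have := ler_norm c; nra.
Qed.

(* To be applied to the moments [u n = B (x, G^n x)] of an operator [G] that is
   symmetric for a positive semidefinite form [B]: repeated squaring turns a crude bound on its
   growth into a sharp bound on its first term. *)
Lemma moment_bound (u : nat -> R) (C K : R) : 0 <= u 0%N -> 0 <= K ->
  (forall n, u n ^+ 2 <= u 0%N * u n.*2) -> (forall n, `|u n| <= C * K ^+ n) ->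
  `|u 1%N| <= K * u 0%N.
Proof.
move=> u0 K0 cs bnd.
have [u00|upos] : u 0%N = 0 \/ 0 < u 0%N by move: u0; rewrite le_eqVlt => /orP[/eqP|]; auto.
  have := cs 1%N; rewrite u00 mul0r mulr0 => h.
  have := sqr_ge0 (u 1%N) => h'.
  by have /eqP : u 1%N ^+ 2 = 0 by [lra|]; rewrite sqrf_eq0 => /eqP ->; rewrite normr0.
rewrite -ler_pdivrMr//.
(* Each use of [cs] bounds the square of the ratio [|u n| / u 0] by the ratio at the doubled
   index. *)
have pw j : (`|u 1%N| / u 0%N) ^+ (2 ^ j) <= `|u (2 ^ j)%N| / u 0%N.
  elim: j => [|j IH]; first by rewrite expr1.
  rewrite expnSr exprM muln2.
  have h0 : 0 <= (`|u 1%N| / u 0%N) ^+ (2 ^ j) by rewrite exprn_ge0// divr_ge0.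
  apply: le_trans (_ : (`|u (2 ^ j)%N| / u 0%N) ^+ 2 <= _).
    by rewrite ler_pXn2r ?nnegrE ?divr_ge0.
  rewrite expr_div_n real_normK ?num_real// [_ ^+ 2 in X in _ / X]expr2 invfM mulrA.
  rewrite ler_pM2r ?invr_gt0// ler_pdivrMr// mulrC.
  by apply: le_trans (cs _) _; rewrite ler_pM2l// ler_norm.
apply: (@exprn2_growth _ _ (C / u 0%N)) => //; first by rewrite divr_ge0.
move=> j; apply: le_trans (pw j) _.
have p0 : (1 : R) <= (2 ^ j)%:R by rewrite ler1n expn_gt0.
rewrite ler_pdivrMr//.
have -> : (2 ^ j)%:R * (C / u 0%N) * K ^+ (2 ^ j) * u 0%N = (2 ^ j)%:R * (C * K ^+ (2 ^ j)).
  by field; rewrite gt_eqF.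
apply: le_trans (bnd _) _; rewrite ler_peMl//.
exact: le_trans (bnd (2 ^ j)%N).
Qed.

End RealLemmas.

(** * Unital C*-algebras with a real-valued norm *)

Record unital_cstar (R : realType) (U : algType R[i]) (star : U -> U) (nrm : U -> R) :
    Prop := UnitalCStar {
  uc_starK : forall x, star (star x) = x ;
  uc_starD : forall x y, star (x + y) = star x + star y ;
  uc_starZ : forall k x, star (k *: x) = Num.conj k *: star x ;
  uc_starM : forall x y, star (x * y) = star y * star x ;
  uc_nrmD : forall x y, nrm (x + y) <= nrm x + nrm y ;
  uc_nrmZ : forall k x, nrm (k *: x) = rnorm k * nrm x ;
  uc_nrmM : forall x y, nrm (x * y) <= nrm x * nrm y ;
  uc_nrm1 : nrm 1 = 1 ;
  uc_nrm_star_mul : forall x, nrm (star x * x) = nrm x ^+ 2 }.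

Section UnitalCStar.
Variables (R : realType) (U : algType R[i]) (star : U -> U) (nrm : U -> R).
Hypothesis HU : unital_cstar star nrm.
Implicit Types (x y k g a : U).

Lemma star1 : star 1 = 1.
Proof. by have := uc_starM HU (star 1) 1; rewrite mulr1 (uc_starK HU) mulr1. Qed.

Lemma starN x : star (- x) = - star x.
Proof. by have := uc_starZ HU (-1) x; rewrite rmorphN1 !scaleN1r. Qed.

Lemma starB x y : star (x - y) = star x - star y.
Proof. by rewrite (uc_starD HU) starN. Qed.

Lemma starX x n : star (x ^+ n) = star x ^+ n.
Proof. by elim: n => [|n IH]; rewrite ?star1// exprSr (uc_starM HU) IH exprS. Qed.

Lemma starRZ (t : R) x : star (t%:C *: x) = t%:C *: star x.
Proof. by rewrite (uc_starZ HU); congr (_ *: _); exact: conjc_real. Qed.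

Lemma nrm0 : nrm 0 = 0.
Proof. by have := uc_nrmZ HU 0 0; rewrite scale0r rnorm0 mul0r. Qed.

Lemma nrmN x : nrm (- x) = nrm x.
Proof. by have := uc_nrmZ HU (-1) x; rewrite scaleN1r rnormN rnorm1 mul1r. Qed.

Lemma nrm_ge0 x : 0 <= nrm x.
Proof. by have := uc_nrmD HU x (- x); rewrite subrr nrm0 nrmN; lra. Qed.

Lemma nrmRZ (t : R) x : nrm (t%:C *: x) = `|t| * nrm x.
Proof. by rewrite (uc_nrmZ HU) rnormC. Qed.

Lemma nrm_star x : nrm (star x) = nrm x.
Proof.
have key y : nrm y <= nrm (star y).
  have h : nrm y * nrm y <= nrm (star y) * nrm y.
    by rewrite -expr2 -(uc_nrm_star_mul HU) (uc_nrmM HU).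
  have := nrm_ge0 y; rewrite le_eqVlt => /orP[/eqP <-|y0]; first exact: nrm_ge0.
  by rewrite -(ler_pM2r y0).
by apply/eqP; rewrite eq_le key -{2}(uc_starK HU x) key.
Qed.

Lemma nrm_sqr k : star k = k -> nrm (k ^+ 2) = nrm k ^+ 2.
Proof. by move=> sk; rewrite -(uc_nrm_star_mul HU) sk -expr2. Qed.

Lemma nrm_expr2n k j : star k = k -> nrm (k ^+ (2 ^ j)) = nrm k ^+ (2 ^ j).
Proof.
move=> sk; elim: j => [|j IH]; first by rewrite !expr1.
by rewrite expnSr !exprM nrm_sqr ?starX ?sk// IH.
Qed.

Lemma nrmX x n : nrm (x ^+ n) <= nrm x ^+ n.
Proof.
elim: n => [|n IH]; first by rewrite !expr0 (uc_nrm1 HU).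
rewrite !exprS; apply: le_trans (uc_nrmM HU _ _) _.
by rewrite ler_wpM2l// nrm_ge0.
Qed.

(** These are the states of [U]; their positivity is derived in [normalized_star_mul_ge0]. *)
Definition normalized (phi : {scalar U}) : Prop :=
  phi 1 = 1 /\ forall x, rnorm (phi x) <= nrm x.

(** [B] is uniform on the unit ball, so for [x] of size [s] the remainder is of order [s^3]. *)
Lemma expand_order3 n : exists2 B : R, 0 <= B & forall x, nrm x <= 1 ->
  exists2 r, nrm r <= B & (1 + x) ^+ n = 1 + x *+ n + x ^+ 2 *+ 'C(n, 2) + x ^+ 3 * r.
Proof.
elim: n => [|n [B B0 IH]].
  exists 0 => // x _; exists 0; first by rewrite nrm0.
  by rewrite !mulr0n mulr0 !addr0 expr0.
exists (B + ('C(n, 2)%:R + B)) => [|x x1].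
  by rewrite !addr_ge0 ?ler0n.
have [r rB e] := IH x x1; exists (r + ('C(n, 2)%:R + x * r)).
  apply: le_trans (uc_nrmD HU _ _) _; rewrite lerD//.
  apply: le_trans (uc_nrmD HU _ _) _; rewrite lerD//.
    by rewrite -scaler_nat (uc_nrmZ HU) (uc_nrm1 HU) mulr1 -(rmorph_nat (real_complex R))
      rnormC ger0_norm ?ler0n.
  apply: le_trans (uc_nrmM HU _ _) _; rewrite -[B]mul1r ler_pM ?nrm_ge0//.
have xn m : x * (x *+ m) = x ^+ 2 *+ m by rewrite mulrnAr.
have x2n m : x * (x ^+ 2 *+ m) = x ^+ 3 * m%:R by rewrite mulrnAr -exprS mulr_natr.
have x3r : x * (x ^+ 3 * r) = x ^+ 3 * (x * r).
  by rewrite (mulrA x (x ^+ 3)) (mulrA _ x r) -exprS -exprSr.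
rewrite exprS e mulrDl mul1r !mulrDr mulr1 xn x2n x3r binS bin1 mulrS mulrnDr.
by rewrite [LHS](AC (4*4) ((1*(5*2))*(3*6)*(4*(7*8)))).
Qed.


End UnitalCStar.

(** * Auxiliary expansions and scalar functionals *)

Section RealExpansion.
Variable R : realType.

Lemma expand_order2 n : exists B : R, forall y : R, 0 <= y -> y <= 1 ->
  (1 + y) ^+ n <= 1 + n%:R * y + B * y ^+ 2.
Proof.
elim: n => [|n [B IH]]; first by exists 0 => y _ _; rewrite expr0 !mul0r !addr0.
exists (`|B| + `|B| + n%:R) => y y0 y1; rewrite exprS -natr1.
apply: le_trans (ler_wpM2l _ (IH y y0 y1)) _; first lra.
have h1 : 0 <= (`|B| - B) * y ^+ 2 by rewrite mulr_ge0 ?sqr_ge0// subr_ge0 ler_norm.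
have h2 : 0 <= (`|B| - B) * y ^+ 2 * y by rewrite mulr_ge0.
have h3 : 0 <= `|B| * y ^+ 2 * (1 - y) by rewrite !mulr_ge0 ?sqr_ge0 ?subr_ge0.
nra.
Qed.

End RealExpansion.

Section Scalar.
Variables (R : realType) (V : lmodType R[i]).
Implicit Types (phi : {scalar V}) (x y : V).

Lemma ReMn (z : R[i]) n : complex.Re (z *+ n) = complex.Re z *+ n.
Proof. by elim: n => [|n IH]; rewrite ?mulr0n// !mulrS ReD IH. Qed.

Lemma scalarD phi x y : phi (x + y) = phi x + phi y.
Proof. exact: linearD. Qed.

Lemma scalarZ phi (c : R[i]) x : phi (c *: x) = c * phi x.
Proof. exact: linearZ. Qed.

Lemma scalarB phi x y : phi (x - y) = phi x - phi y.
Proof. exact: linearB. Qed.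

Lemma scalarMn phi x n : phi (x *+ n) = phi x *+ n.
Proof. exact: raddfMn. Qed.

End Scalar.

(** * Normalized functionals on selfadjoint elements and their squares *)

Section NormalizedFunctionals.
Variables (R : realType) (U : algType R[i]) (star : U -> U) (nrm : U -> R).
Hypothesis HU : unital_cstar star nrm.
Implicit Types (x y k g a : U) (phi : {scalar U}).

Lemma conj_i : Num.conj ('i : R[i]) = - 'i.
Proof. by apply/eqP; rewrite eq_complex/= oppr0 !eqxx. Qed.

(** For commuting selfadjoint [h] and [k], the cross terms of [(h - i k) (h + i k)] cancel; the
    C*-identity does the rest. *)
Lemma nrm_cart h k : star h = h -> star k = k -> h * k = k * h ->
  nrm (h + 'i *: k) ^+ 2 = nrm (h ^+ 2 + k ^+ 2).
Proof.
move=> sh sk hk; rewrite -(uc_nrm_star_mul HU) (uc_starD HU) (uc_starZ HU) sh sk conj_i.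
congr nrm; rewrite mulrDl !mulrDr -!scalerAr -!scalerAl hk scalerA.
rewrite mulrN -!expr2 sqr_i opprK scale1r scaleNr.
by rewrite addrA addrK.
Qed.

(** Adding [i t] to [k] adds [t] to the imaginary part [b] but at most [t^2] to the squared norm, so
    [(b + t)^2 <= |k|^2 + t^2] for every real [t]. *)
Lemma normalized_real phi k : normalized nrm phi -> star k = k -> complex.Im (phi k) = 0.
Proof.
move=> [phi1 phile] sk; set b := complex.Im (phi k).
have key (t : R) : (b + t) ^+ 2 <= nrm k ^+ 2 + t ^+ 2.
  have st : star (t%:C *: 1) = t%:C *: 1 by rewrite (starRZ HU) (star1 HU).
  have comm : k * (t%:C *: 1) = t%:C *: 1 * k by rewrite -scalerAr -scalerAl mulr1 mul1r.
  have := phile (k + 'i *: (t%:C *: 1)).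
  rewrite -(@ler_pXn2r _ 2) ?nnegrE ?rnorm_ge0 ?(nrm_ge0 HU)// (nrm_cart sk st comm).
  rewrite scalarD !scalarZ phi1 mulr1 sqr_rnorm => h.
  apply: le_trans (_ : nrm (k ^+ 2 + (t%:C *: 1) ^+ 2) <= _).
    apply: le_trans h; rewrite ler_wpDl ?sqr_ge0//.
    by rewrite (_ : complex.Im _ = b + t)// /b; case: (phi k) => u v /=; ring.
  apply: le_trans (uc_nrmD HU _ _) _; rewrite (nrm_sqr HU sk) lerD2l.
  by rewrite (nrm_sqr HU st) (nrmRZ HU) (uc_nrm1 HU) mulr1 real_normK ?num_real.
apply/eqP; apply/negPn/negP => b0.
(* This [t] makes the cross term [2 b t] equal to [2 (|k|^2 + 1)], which is too large. *)
have := key ((nrm k ^+ 2 + 1) / b).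
have -> : (b + (nrm k ^+ 2 + 1) / b) ^+ 2 =
  b ^+ 2 + 2 * (nrm k ^+ 2 + 1) + ((nrm k ^+ 2 + 1) / b) ^+ 2 by field.
by have := sqr_ge0 b; have := sqr_ge0 (nrm k); lra.
Qed.

(** With [x = i s k], the term of order [s^2] in [phi ((1 + x)^(2m))] is [- C(2m, 2) mu s^2], while
    [|1 + x|^(2m) <= (1 + s^2 K^2)^m]. Letting [s] tend to 0 gives [- mu m (2m - 1) <= m K^2] for
    every [m]. *)
Lemma normalized_sqr_ge0 phi k : normalized nrm phi -> star k = k ->
  0 <= complex.Re (phi (k ^+ 2)).
Proof.
move=> nphi sk; have [phi1 phile] := nphi.
set mu := complex.Re _; set K := nrm k; have K0 : 0 <= K := nrm_ge0 HU k.
have key m : - mu * 'C(m.*2, 2)%:R <= m%:R * K ^+ 2.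
  have [B B0 HB] := expand_order3 HU m.*2.
  have [B' HB'] := expand_order2 R m.
  (* The range of [s] keeps [s <= 1] and [s K <= 1]; the factor of [s] collects the remainders of
     orders 3 and 4. *)
  apply: (@le_of_le_add_small _ _ _ (`|B'| * K ^+ 4 + K ^+ 3 * B) (1 + K)^-1).
    by rewrite invr_gt0; lra.
  move=> s s0 sK.
  have s1K : s * (1 + K) <= 1 by rewrite -ler_pdivlMr ?div1r//; lra.
  have s1 : s <= 1 by nra.
  have sk' : star (s%:C *: k) = s%:C *: k by rewrite (starRZ HU) sk.
  pose x := 'i *: (s%:C *: k).
  have nx : nrm x = s * K.
    by rewrite (uc_nrmZ HU) rnorm_i mul1r (nrmRZ HU) ger0_norm// ltW.
  have [r rB e] : exists2 r, nrm r <= B & (1 + x) ^+ m.*2 =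
      1 + x *+ m.*2 + x ^+ 2 *+ 'C(m.*2, 2) + x ^+ 3 * r.
    by apply: HB; rewrite nx; nra.
  have n1x : nrm (1 + x) ^+ 2 <= 1 + (s * K) ^+ 2.
    rewrite (nrm_cart (star1 HU) sk') ?mulr1 ?mul1r//.
    apply: le_trans (uc_nrmD HU _ _) _; rewrite expr1n (uc_nrm1 HU) lerD2l.
    by rewrite (nrm_sqr HU sk') (nrmRZ HU) ger0_norm ?(ltW s0).
  have up : complex.Re (phi ((1 + x) ^+ m.*2)) <= 1 + m%:R * (s * K) ^+ 2 + B' * (s * K) ^+ 4.
    apply: le_trans (ler_Re _) _; apply: le_trans (phile _) _.
    apply: le_trans (nrmX HU _ _) _; rewrite -mul2n exprM.
    apply: le_trans (_ : (1 + (s * K) ^+ 2) ^+ m <= _).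
      by rewrite lerXn2r ?nnegrE ?exprn_ge0 ?(nrm_ge0 HU)// addr_ge0 ?sqr_ge0.
    have := HB' ((s * K) ^+ 2); rewrite -exprM; apply; first exact: sqr_ge0.
    by rewrite expr_le1 ?mulr_ge0 ?(ltW s0)//; nra.
  have x2 : x ^+ 2 = (- s ^+ 2)%:C *: k ^+ 2.
    by rewrite /x !exprZn scalerA sqr_i mulN1r rmorphN rmorphXn.
  have rest : - (s ^+ 3 * K ^+ 3 * B) <= complex.Re (phi (x ^+ 3 * r)).
    rewrite lerNl; apply: le_trans (_ : rnorm (phi (x ^+ 3 * r)) <= _).
      by rewrite -rnormN; apply: le_trans (ler_Re _); case: (phi _).
    apply: le_trans (phile _) _; apply: le_trans (uc_nrmM HU _ _) _.
    rewrite -exprMn -nx ler_pM ?(nrm_ge0 HU) ?(nrmX HU)//.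
  move: up; rewrite e !scalarD !ReD phi1 !scalarMn !ReMn.
  (* The linear term is purely imaginary because [phi k] is real. *)
  have -> : complex.Re (phi x) = 0.
    rewrite /x !scalarZ; have := normalized_real nphi sk.
    by case: (phi k) => u v /= ->; ring.
  rewrite x2 scalarZ ReZ -/mu mul0rn.
  rewrite -[_ *+ 'C(_, _)]mulr_natr (_ : complex.Re 1 = 1)// => up.
  have {}up : - mu * 'C(m.*2, 2)%:R * s ^+ 2 <=
     (m%:R * K ^+ 2 + s * (`|B'| * K ^+ 4 + K ^+ 3 * B)) * s ^+ 2.
    have h1 : 0 <= (`|B'| - B') * (s * K) ^+ 4.
      by rewrite mulr_ge0 ?subr_ge0 ?ler_norm// exprn_ge0// mulr_ge0// (ltW s0).
    have h2 : 0 <= `|B'| * (s * K) ^+ 4 / s * (1 - s).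
      by rewrite mulr_ge0 ?subr_ge0// divr_ge0 ?(ltW s0)// mulr_ge0// exprn_ge0//
        mulr_ge0// (ltW s0).
    have -> : (m%:R * K ^+ 2 + s * (`|B'| * K ^+ 4 + K ^+ 3 * B)) * s ^+ 2 =
      m%:R * (s * K) ^+ 2 + `|B'| * (s * K) ^+ 4 / s + s ^+ 3 * K ^+ 3 * B.
      by field; rewrite gt_eqF.
    have h3 : `|B'| * (s * K) ^+ 4 / s * (1 - s) = `|B'| * (s * K) ^+ 4 / s - `|B'| * (s * K) ^+ 4.
      by field; rewrite gt_eqF.
    lra.
  by rewrite ler_pM2r ?exprn_gt0 in up.
rewrite leNgt; apply/negP => mu0.
apply: (@unbounded_nat R (K ^+ 2) (- mu)); first lra.
case=> [|m]; first by rewrite mul0r sqr_ge0.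
have := key m.+1; rewrite bin2 -doubleMl doubleK natrM mulrCA.
rewrite ler_pM2l ?ltr0n// => h; apply: le_trans h; rewrite mulrC ler_wpM2l//; first lra.
by rewrite ler_nat doubleS/= ltnS -addnn leq_addl.
Qed.

End NormalizedFunctionals.

(** * The largest term of a binomial expansion *)

Section BinomialMax.

Let T l n j := ('C(n * l.+1, j) * l ^ (n * l.+1 - j))%N.

Lemma binomial_term_step l n j : (0 < l)%N -> (j < n * l.+1)%N ->
  (T l n j.+1 * (j.+1 * l) = (n * l.+1 - j) * T l n j)%N.
Proof.
move=> l0 jN; rewrite /T; set N := (n * l.+1)%N in jN *.
rewrite mulnACA [(_ * j.+1)%N]mulnC mul_bin_left -expnSr (subnSK jN).
by rewrite mulnA.
Qed.

(** With [N = n (l + 1)], the terms of index [j + 1] and [j] have ratio [(N - j) / ((j + 1) l)],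
    which is at least 1 exactly when [j < n]. *)
Lemma binomial_term_max l n j : (0 < l)%N -> (j <= n * l.+1)%N -> (T l n j <= T l n n)%N.
Proof.
move=> l0; have [jn _|nj] := leqP j n.
  elim: (n - j)%N {-2}j jn (erefl (n - j)%N) => [|d IH] i inn e.
    by have -> : i = n by lia.
  have lt : (i < n)%N by lia.
  apply: leq_trans (IH i.+1 lt _); last by lia.
  have iN : (i < n * l.+1)%N by nia.
  have e0 : (0 < n * l.+1 - i)%N by lia.
  rewrite -(leq_pmul2l e0) -binomial_term_step// mulnC leq_mul//; nia.
elim: j nj => // j IH nj jN.
have [<-|nj'] := eqVneq n j.+1; first by [].
have nj2 : (n <= j)%N by lia.
have le1 : (T l n j <= T l n n)%N.
  by have [<-|] := eqVneq n j; [|move=> ?; apply: IH; lia].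
apply: leq_trans le1.
have p0 : (0 < j.+1 * l)%N by rewrite muln_gt0.
rewrite -(leq_pmul2r p0) binomial_term_step// mulnC leq_mul//; nia.
Qed.

(** The largest of the [N + 1] terms of [(l + 1)^N] is at least their average. *)
Lemma binomial_term_lower l n : (0 < l)%N ->
  (l.+1 ^ (n * l.+1) <= (n * l.+1).+1 * ('C(n * l.+1, n) * l ^ (n * l)))%N.
Proof.
move=> l0; rewrite -[l.+1]addn1 expnDn addn1.
apply: leq_trans (_ : \sum_(i < (n * l.+1).+1) T l n n <= _)%N.
  apply: leq_sum => i _; rewrite exp1n muln1; apply: binomial_term_max => //.
  by rewrite -ltnS.
by rewrite sum_nat_const card_ord /T (_ : n * l.+1 - n = n * l)%N//; lia.
Qed.

End BinomialMax.

(** * A discriminant inequality *)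

Section Discriminant.
Variable R : realType.

Lemma discriminant_le (A B D : R) : 0 <= A ->
  (forall t, 0 <= t ^+ 2 * A + 2 * t * B + D) -> B ^+ 2 <= A * D.
Proof.
move=> A0 H; have [A00|A1] : A = 0 \/ 0 < A.
    by move: A0; rewrite le_eqVlt => /orP[/eqP|]; auto.
  have [->|B0] := eqVneq B 0; first by rewrite A00 mul0r expr0n.
  (* With [A = 0] the expression is affine in [t], and this [t] gives it the value -1. *)
  have := H (- (D + 1) / (2 * B)).
  have -> : (- (D + 1) / (2 * B)) ^+ 2 * A + 2 * (- (D + 1) / (2 * B)) * B + D = -1.
    by rewrite A00; field.
  by rewrite lerNr oppr0 ler10.
have := H (- B / A).
have -> : (- B / A) ^+ 2 * A + 2 * (- B / A) * B + D = (A * D - B ^+ 2) / A.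
  by field; rewrite gt_eqF.
by rewrite pmulr_lge0 ?invr_gt0// subr_ge0.
Qed.

End Discriminant.

(** * Norms of [1 + k] and [1 - k] for selfadjoint [k] *)

Section Norming.
Variables (R : realType) (U : algType R[i]) (star : U -> U) (nrm : U -> R).
Hypothesis HU : unital_cstar star nrm.
Implicit Types (x y k g a : U) (phi : {scalar U}).

Lemma sum_double (F : nat -> U) n :
  \sum_(0 <= j < n.*2) F j = \sum_(0 <= j < n) (F j.*2 + F j.*2.+1).
Proof.
elim: n => [|n IH]; first by rewrite !big_geq.
by rewrite doubleS !big_nat_recr//= IH addrA.
Qed.

(** A Cauchy estimate by halving: if [p w = e (w^2) + w o (w^2)], half the sum and half the
    difference of [p w] and [p (- w)] bound [e] and [o] on the circle by the same [M]. *)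
Lemma coef_bound r : forall (c : nat -> U) (M : R),
  (forall z : R[i], rnorm z = 1 -> nrm (\sum_(0 <= j < 2 ^ r) z ^+ j *: c j) <= M) ->
  forall j, (j < 2 ^ r)%N -> nrm (c j) <= M.
Proof.
elim: r => [|r IH] c M H j jr.
  have := H 1 (rnorm1 R); rewrite big_nat1 expr0 scale1r.
  by move: jr; rewrite expn0 ltnS leqn0 => /eqP ->.
pose e z := \sum_(0 <= j < 2 ^ r) z ^+ j *: c j.*2.
pose o z := \sum_(0 <= j < 2 ^ r) z ^+ j *: c j.*2.+1.
have split_eo (w : R[i]) : \sum_(0 <= j < 2 ^ r.+1) w ^+ j *: c j = e (w ^+ 2) + w *: o (w ^+ 2).
  rewrite expnS mul2n sum_double big_split/=; congr (_ + _).
    by apply: eq_bigr => i _; rewrite -exprM mul2n.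
  by rewrite scaler_sumr; apply: eq_bigr => i _; rewrite scalerA -exprM mul2n -exprS.
have bnd (z : R[i]) : rnorm z = 1 -> nrm (e z) <= M /\ nrm (o z) <= M.
  move=> z1; pose w := sqrtC z; have wz : w ^+ 2 = z by rewrite sqrtCK.
  have w1 : rnorm w = 1.
    by apply/eqP; rewrite -(@eqrXn2 _ 2) ?rnorm_ge0// -rnormX wz z1 expr1n.
  have := H w w1; have := H (- w); rewrite rnormN => /(_ w1).
  rewrite !split_eo sqrrN wz scaleNr => hm hp.
  have two y : nrm (y + y) = 2 * nrm y.
    by rewrite -mulr2n -scaler_nat (uc_nrmZ HU) -(rmorph_nat (real_complex R)) rnormC ger0_norm.
  split; rewrite -(@ler_pM2l _ 2)// -two.
    have -> : e z + e z = (e z + w *: o z) + (e z - w *: o z) by rewrite addrACA subrr addr0.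
    by have := uc_nrmD HU (e z + w *: o z) (e z - w *: o z); lra.
  have -> : nrm (o z + o z) = nrm ((e z + w *: o z) - (e z - w *: o z)).
    have -> : (e z + w *: o z) - (e z - w *: o z) = w *: (o z + o z).
      by rewrite opprB addrC addrA subrK scalerDr.
    by rewrite (uc_nrmZ HU) w1 mul1r.
  by have := uc_nrmD HU (e z + w *: o z) (- (e z - w *: o z)); rewrite (nrmN HU); lra.
have jr2 : (j./2 < 2 ^ r)%N by rewrite ltn_half_double -mul2n -expnS.
rewrite -[j]odd_double_half; case: (odd j).
  by apply: (IH (fun i => c i.*2.+1)) jr2 => z /bnd[].
by apply: (IH (fun i => c i.*2)) jr2 => z /bnd[].
Qed.

Lemma affine_mul k (a b a' b' : R[i]) :
  (a *: 1 + b *: k) * (a' *: 1 + b' *: k) =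
  (a * a') *: 1 + (a * b' + b * a') *: k + (b * b') *: k ^+ 2.
Proof.
rewrite mulrDl !mulrDr -!scalerAl -!scalerAr !mul1r !mulr1 !scalerA -expr2.
by rewrite scalerDl !addrA.
Qed.

(** By the C*-identity the squared norm is that of a convex combination of [(l + k)^2] and
    [(l - k)^2], with weights [(1 + c) / 2] and [(1 - c) / 2]. *)
Lemma nrm_circle k (l q : R) (z : R[i]) : star k = k -> 0 <= l ->
  nrm (l%:C *: 1 + k) <= l + q -> nrm (l%:C *: 1 - k) <= l + q -> rnorm z = 1 ->
  nrm (l%:C *: 1 + z *: k) <= l + q.
Proof.
move=> sk l0 hp hm z1.
have lq : 0 <= l + q := le_trans (nrm_ge0 HU _) hp.
have sl : star (l%:C *: 1) = l%:C *: 1 by rewrite (starRZ HU) (star1 HU).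
set c := complex.Re z.
have c1 : -1 <= c <= 1.
  by rewrite -ler_norml -(@expr_le1 _ 2)// real_normK ?num_real// -(expr1n R 2) -z1
    sqr_rnorm lerDl sqr_ge0.
rewrite -(@ler_pXn2r _ 2) ?nnegrE ?(nrm_ge0 HU)// -(uc_nrm_star_mul HU).
have -> : star (l%:C *: 1 + z *: k) * (l%:C *: 1 + z *: k) =
   ((1 + c) / 2)%:C *: (l%:C *: 1 + k) ^+ 2 + ((1 - c) / 2)%:C *: (l%:C *: 1 - k) ^+ 2.
  rewrite (uc_starD HU) sl (uc_starZ HU) sk affine_mul.
  have -> : l%:C *: 1 + k = l%:C *: 1 + 1 *: k by rewrite scale1r.
  have -> : l%:C *: 1 - k = l%:C *: 1 + (-1) *: k by rewrite scaleN1r.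
  rewrite !expr2 !affine_mul !scalerDr !scalerA [RHS]addrACA [X in _ = X + _]addrACA -!scalerDl.
  rewrite conj_mul z1 expr1n; congr (_ *: _ + _ *: _ + _ *: _).
  - by rewrite -mulrDl -rmorphD/= (_ : (1 + c) / 2 + (1 - c) / 2 = 1) ?mul1r//; field.
  - rewrite mulrC -mulrDl addcJ -/c !(mul1r, mulr1, mulrN1, mulN1r).
    have -> : (2 : R[i]) = (2 : R)%:C by rewrite rmorph_nat.
    by rewrite -!rmorphN -!rmorphD -!rmorphM -rmorphD/=; congr (_%:C); field.
  - by rewrite mulrNN !mulr1 -rmorphD/= (_ : (1 + c) / 2 + (1 - c) / 2 = 1)//; field.
apply: le_trans (uc_nrmD HU _ _) _; rewrite !(nrmRZ HU) !ger0_norm; try lra.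
have h1 : nrm ((l%:C *: 1 + k) ^+ 2) <= (l + q) ^+ 2.
  by apply: le_trans (nrmX HU _ _) _; rewrite ler_pXn2r ?nnegrE ?(nrm_ge0 HU).
have h2 : nrm ((l%:C *: 1 - k) ^+ 2) <= (l + q) ^+ 2.
  by apply: le_trans (nrmX HU _ _) _; rewrite ler_pXn2r ?nnegrE ?(nrm_ge0 HU).
nra.
Qed.

(** The coefficient of [z^n] in [(l + z k)^N] has norm at most [(l + q)^N]. For [l = L q] and
    [N = n (L + 1)], the term of index [n] is the largest in the expansion of [(l + q)^N], so
    [|k|^n <= (N + 1) q^n], with a factor only linear in [n]. *)
Lemma nrm_le_of_pm k (q : R) : star k = k -> 0 < q ->
  nrm (1 + k) <= 1 + q -> nrm (1 - k) <= 1 + q -> nrm k <= q.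
Proof.
move=> sk q0 hp hm.
(* [L] is so large that [l = L q >= 1]; the triangle inequality then carries the hypotheses from [1]
   to [l]. *)
pose L := Num.Def.archi_bound q^-1.
have L1 : 1 <= L%:R * q.
  by rewrite -ler_pdivrMr// div1r ltW// archi_boundP// invr_ge0 ltW.
have L0 : (0 < L)%N by rewrite lt0n; apply/eqP => L00; move: L1; rewrite L00 mul0r ler10.
have [l lE] : exists l, l = L%:R * q by exists (L%:R * q).
rewrite -lE in L1.
have hl y : nrm (1 + y) <= 1 + q -> nrm (l%:C *: 1 + y) <= l + q.
  move=> h; have -> : l%:C *: 1 + y = (l - 1)%:C *: 1 + (1 + y).
    by rewrite rmorphB scalerBl scale1r addrA subrK.
  apply: le_trans (uc_nrmD HU _ _) _; rewrite (nrmRZ HU) (uc_nrm1 HU) ger0_norm; lra.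
apply: (@exprn2_growth _ _ _ (L.+2)%:R) => [||j]; [exact: (nrm_ge0 HU)|exact: ltW|].
(* A power of two, so that [|k^n| = |k|^n]. *)
set n := (2 ^ j)%N; set N := (n * L.+1)%N.
pose c i := ((l ^+ (N - i))%:C *: k ^+ i) *+ 'C(N, i).
have cb : nrm (c n) <= (l + q) ^+ N.
  (* The sum is padded to [2 ^ N] terms: the binomials vanish beyond [N]. *)
  apply: (@coef_bound N c); last first.
    by apply: leq_trans (ltn_expl N (isT : 1 < 2)%N); rewrite ltnS leq_pmulr.
  move=> z z1; have := nrm_circle sk (le_trans ler01 L1) (hl _ hp) (hl _ hm) z1 => h.
  apply: le_trans (_ : nrm ((l%:C *: 1 + z *: k) ^+ N) <= _); last first.
    by apply: le_trans (nrmX HU _ _) _; rewrite lerXn2r ?nnegrE ?(nrm_ge0 HU)//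
      (le_trans _ h)// (nrm_ge0 HU).
  rewrite le_eqVlt; apply/orP; left; apply/eqP; congr nrm.
  rewrite exprDn_comm; last first.
    by rewrite /GRing.comm -!scalerAr -!scalerAl !mulr1 !mul1r scalerA scalerA mulrC.
  rewrite (@big_cat_nat _ _ _ N.+1)//=; last exact: ltn_expl.
  rewrite [X in _ + X]big1_seq ?addr0; last first.
    by move=> i; rewrite mem_index_iota /= => /andP[Ni _]; rewrite /c bin_small// mulr0n scaler0.
  rewrite big_mkord; apply: eq_bigr => i _.
  by rewrite /c scalerMnr scalerA !exprZn expr1n -scalerAl mul1r scalerA -rmorphXn mulrC scalerMnr.
have cn : nrm (c n) = 'C(N, n)%:R * l ^+ (n * L) * nrm k ^+ n.
  rewrite /c -scaler_nat (uc_nrmZ HU) (nrmRZ HU) (nrm_expr2n HU)// mulrA.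
  rewrite -(rmorph_nat (real_complex R)) rnormC !ger0_norm ?exprn_ge0 ?(le_trans ler01 L1)//.
  by congr (_ * _ ^+ _ * _); rewrite /N; lia.
have bl := binomial_term_lower n L0; rewrite -/N -(ler_nat R) !natrM !natrX in bl.
have {cb}cb : 'C(N, n)%:R * (L%:R ^+ (n * L) * q ^+ (n * L)) * nrm k ^+ n <= L.+1%:R ^+ N * q ^+ N.
  have e : L.+1%:R * q = l + q by rewrite lE -[L.+1%:R]natr1 mulrDl mul1r.
  by rewrite -!exprMn e -lE -cn.
have p0 : 0 < 'C(N, n)%:R * L%:R ^+ (n * L) * q ^+ (n * L).
  by rewrite !mulr_gt0 ?exprn_gt0 ?ltr0n// bin_gt0 leq_pmulr.
rewrite -(ler_pM2l p0).
apply: le_trans (_ : L.+1%:R ^+ N * q ^+ N <= _); first by rewrite -[_ * _ * q ^+ _]mulrA.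
apply: le_trans (ler_wpM2r _ bl) _; first by rewrite exprn_ge0 ?ltW.
have -> : q ^+ N = q ^+ (n * L) * q ^+ n by rewrite -exprD; congr (_ ^+ _); rewrite /N; lia.
have Nn : (N.+1%:R : R) <= n%:R * L.+2%:R.
  have n0 : (0 < n)%N by rewrite expn_gt0.
  by rewrite -natrM ler_nat /N !mulnS; lia.
rewrite [leLHS](_ : _ = 'C(N, n)%:R * L%:R ^+ (n * L) * q ^+ (n * L) *
  (N.+1%:R * q ^+ n)); last by ring.
by rewrite ler_pM2l//; apply: ler_wpM2r Nn; rewrite exprn_ge0 ?(ltW q0).
Qed.

(** If both norms were below [1 + |k|], some [q < |k|] would contradict [nrm_le_of_pm]. *)
Lemma nrm_one_pm k : star k = k -> exists2 e : R, e = 1 \/ e = -1 &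
  1 + nrm k <= nrm (1 + e%:C *: k).
Proof.
move=> sk; have [h|hp] := leP (1 + nrm k) (nrm (1 + k)).
  by exists 1; [left|rewrite scale1r].
have [h|hm] := leP (1 + nrm k) (nrm (1 - k)).
  by exists (-1); [right|rewrite rmorphN scaleN1r].
(* Here [2 = |(1 + k) + (1 - k)| < 2 + 2 |k|]. *)
have K0 : 0 < nrm k.
  have := uc_nrmD HU (1 + k) (1 - k); rewrite addrACA subrr addr0.
  have -> : 1 + 1 = 2%:C *: (1 : U) by rewrite -[2]/(1 + 1) rmorphD scalerDl scale1r.
  by rewrite (nrmRZ HU) (uc_nrm1 HU) ger0_norm//; lra.
(* The entry [nrm k / 2] keeps [q] positive. *)
pose q := Num.max (Num.max (nrm (1 + k) - 1) (nrm (1 - k) - 1)) (nrm k / 2).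
have q0 : 0 < q by rewrite lt_max divr_gt0// orbT.
have qp : nrm (1 + k) - 1 <= q by rewrite !le_max lexx.
have qm : nrm (1 - k) - 1 <= q by rewrite !le_max lexx orbT.
have qK : q < nrm k by rewrite !gt_max; apply/andP; split; [apply/andP; split|]; lra.
have : nrm k <= q by apply: nrm_le_of_pm => //; lra.
by rewrite leNgt qK.
Qed.

End Norming.

Lemma ReN (R : realType) (z : R[i]) : complex.Re (- z) = - complex.Re z.
Proof. by case: z. Qed.

(** * Norming functionals and positivity of normalized functionals *)

Section Positivity.
Variables (R : realType) (U : algType R[i]) (star : U -> U) (nrm : U -> R).
Hypothesis HU : unital_cstar star nrm.
Implicit Types (x y k g a b : U) (phi : {scalar U}).

(** A real functional dominated by [nrm] that attains [|1 + e k| >= 1 + |k|] must take the extreme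
    values 1 at [1] and [|k|] at [e k]. *)
Lemma norming_functional k : star k = k ->
  exists2 phi : {scalar U}, normalized nrm phi & `|complex.Re (phi k)| = nrm k.
Proof.
move=> sk; have [e e1 ek] := nrm_one_pm HU sk.
have ae : `|e| = 1 by case: e1 => ->; rewrite ?normrN normr1.
have sub : sublinear nrm.
  by split=> [x y|t x t0]; [exact: (uc_nrmD HU)|rewrite (nrmRZ HU) ger0_norm].
have [f [[fD fZ] fle fx]] := hahn_banach_attained (1 + e%:C *: k) sub.
have f1 := fle 1; rewrite (uc_nrm1 HU) in f1.
have fk := fle (e%:C *: k); rewrite (nrmRZ HU) ae mul1r fZ in fk.
have fs : f 1 + e * f k = nrm (1 + e%:C *: k) by rewrite -fx fD fZ.
(* The complex-linear functional with real part [f]. *)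
pose F x : R[i] := (f x) +i* (- f ('i *: x)).
have cE (c : R[i]) x : c *: x = (complex.Re c)%:C *: x + (complex.Im c)%:C *: ('i *: x).
  by rewrite scalerA -scalerDl [_%:C * _]mulrC -complexE.
have Flin : GRing.linear_for *%R F.
  move=> c x y; rewrite /F.
  have -> : 'i *: (c *: x + y) = (- complex.Im c)%:C *: x +
      (complex.Re c)%:C *: ('i *: x) + 'i *: y.
    rewrite scalerDr {1}(cE c) scalerDr !scalerA; congr (_ + _).
    by rewrite addrC mulrAC -expr2 sqr_i mulN1r mulrC rmorphN.
  rewrite {1}(cE c) !fD !fZ; case: c => u v /=.
  by apply/eqP; rewrite eq_complex/=; apply/andP; split; apply/eqP; ring.
pose phi : {scalar U} := HB.pack F (GRing.isLinear.Build _ _ _ _ F Flin).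
have phiE x : phi x = F x by [].
have le x : rnorm (phi x) <= nrm x.
  have [w w1 <-] := rotate (phi x).
  rewrite -scalarZ phiE /F/=; apply: le_trans (fle _) _.
  by rewrite (uc_nrmZ HU) w1 mul1r.
exists phi; last first.
  by rewrite phiE/= -[nrm k]ger0_norm ?(nrm_ge0 HU)// -[LHS]mul1r -ae -normrM; congr (`|_|); lra.
split=> //; have h := le 1; rewrite (uc_nrm1 HU) phiE in h.
have f1E : f 1 = 1 by lra.
(* With real part 1 and modulus at most 1, [F 1] has no imaginary part. *)
have : rnorm (F 1) ^+ 2 <= 1 by rewrite expr_le1 ?rnorm_ge0.
rewrite sqr_rnorm /= f1E expr1n gerDl sqrrN => i0.
have : f ('i *: 1) ^+ 2 = 0 by apply/eqP; rewrite eq_le i0 sqr_ge0.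
move/eqP; rewrite sqrf_eq0 => /eqP i00.
by apply: etrans (phiE 1) _; rewrite /F f1E i00 oppr0.
Qed.

(** [moment_bound] applies to the moments [u n = phi (g a^n g)] with [K = |a| <= 1], and yields
    [u 1 <= u 0]. *)
Lemma normalized_sandwich_ge0 phi g a : normalized nrm phi -> star g = g -> star a = a ->
  nrm a <= 1 -> g * a = a * g -> 0 <= complex.Re (phi (g * (1 - a) * g)).
Proof.
move=> nphi sg sa a1 ga.
pose u n := complex.Re (phi (g * a ^+ n * g)).
have gan n : g * a ^+ n = a ^+ n * g by exact: commrX.
have u0E : u 0%N = complex.Re (phi (g ^+ 2)) by rewrite /u expr0 mulr1 expr2.
have u0 : 0 <= u 0%N by rewrite u0E (normalized_sqr_ge0 HU).
have cs n : u n ^+ 2 <= u 0%N * u n.*2.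
  (* As [g] and [a] commute, [t g + g a^n] is selfadjoint, and [phi] is nonnegative on its
     square. *)
  apply: discriminant_le => // t.
  have st : star (t%:C *: g + g * a ^+ n) = t%:C *: g + g * a ^+ n.
    by rewrite (uc_starD HU) (starRZ HU) (uc_starM HU) (starX HU) sg sa gan.
  have := normalized_sqr_ge0 HU nphi st.
  have -> : (t%:C *: g + g * a ^+ n) ^+ 2 = (t ^+ 2)%:C *: (g * a ^+ 0 * g) +
      (2 * t)%:C *: (g * a ^+ n * g) + g * a ^+ n.*2 * g.
    have h1 : g * (g * a ^+ n) = g * a ^+ n * g by rewrite {1}gan mulrA.
    have h2 : g * a ^+ n * (g * a ^+ n) = g * a ^+ n.*2 * g.
      by rewrite {2}gan -addnn exprD !mulrA.
    rewrite expr0 mulr1 expr2 mulrDl !mulrDr -!scalerAl -!scalerAr scalerA -rmorphM -expr2.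
    by rewrite h1 h2 !addrA -[_ + _ + _ *: _]addrA -scalerDl -rmorphD -mulr2n mulr_natl.
  by rewrite !scalarD !ReD !scalarZ !ReZ.
have bnd n : `|u n| <= nrm g ^+ 2 * nrm a ^+ n.
  apply: le_trans (_ : nrm (g * a ^+ n * g) <= _).
    have h y : complex.Re (phi y) <= nrm y := le_trans (ler_Re _) (nphi.2 y).
    rewrite ler_norml h andbT lerNl -(nrmN HU).
    by have := h (- (g * a ^+ n * g)); rewrite -scaleN1r scalarZ mulN1r ReN.
  apply: le_trans (uc_nrmM HU _ _) _; rewrite expr2 mulrAC ler_wpM2r ?(nrm_ge0 HU)//.
  by apply: le_trans (uc_nrmM HU _ _) _; rewrite ler_wpM2l ?(nrm_ge0 HU)// (nrmX HU).
have := moment_bound u0 (nrm_ge0 HU a) cs bnd.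
have -> : complex.Re (phi (g * (1 - a) * g)) = u 0%N - u 1%N.
  by rewrite /u expr0 expr1 mulr1 mulrBr mulr1 mulrBl scalarB ReD ReN.
have := ler_norm (u 1%N); nra.
Qed.

(** Identities in the single element [a] of the noncommutative [U] are checked by [ring] on
    polynomials and then evaluated at [a]. *)
Lemma horner_alg_eq a (p q : {poly R[i]}) : p = q -> horner_alg a p = horner_alg a q.
Proof. by move=> ->. Qed.

Lemma cubic_lower a : a = a * (1 - a) ^+ 2 + a ^+ 2 + a * (1 - a) * a.
Proof.
have e : 'X = 'X * (1 - 'X) ^+ 2 + 'X ^+ 2 + 'X * (1 - 'X) * 'X :> {poly R[i]} by ring.
have := horner_alg_eq a e.
by rewrite !(rmorphD, rmorphM, rmorphN, rmorphXn, rmorph1)/= horner_algX.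
Qed.

(** [4 / 27] is the maximum of [t (1 - t)^2] on [[0, 1]], attained at [1 / 3], whence the double
    root there. *)
Lemma cubic_upper a : let g := a - (3^-1)%:A in
  (4 / 27)%:A - a * (1 - a) ^+ 2 = 3^-1 *: g ^+ 2 + g * (1 - a) * g.
Proof.
have e : (4 / 27)%:P - 'X * (1 - 'X) ^+ 2 =
  (3^-1)%:P * ('X - (3^-1)%:P) ^+ 2 + ('X - (3^-1)%:P) * (1 - 'X) * ('X - (3^-1)%:P) :> {poly R[i]}.
  have -> : (4 / 27)%:P = 4 * (3^-1)%:P ^+ 3 :> {poly R[i]}.
    by rewrite -polyC_exp -(polyC_natr _ 4) -polyCM; congr (_%:P); field.
  have : 3 * (3^-1)%:P = 1 :> {poly R[i]}.
    by rewrite -(polyC_natr _ 3) -polyCM mulfV// pnatr_eq0.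
  (* With [1 / 3] generalized to [t], the two sides differ by a multiple of [3 t - 1]. *)
  move: (_%:P) => t t3; apply/eqP; rewrite -subr_eq0.
  rewrite [X in X == 0](_ : _ = (3 * t - 1) * (t ^+ 2 - 'X ^+ 2 + 'X * (t + 1))); last by ring.
  by rewrite t3 subrr mul0r.
move: (4 / 27 : R[i]) (3^-1 : R[i]) e => c d e /=.
have := horner_alg_eq a e.
rewrite !(rmorphD, rmorphM, rmorphN, rmorphXn, rmorph1)/= horner_algX !horner_algC.
by rewrite -scalerAl mul1r.
Qed.

Lemma normalized_cubic_le phi a : normalized nrm phi -> star a = a -> nrm a <= 1 ->
  complex.Re (phi (a * (1 - a) ^+ 2)) <= 4 / 27.
Proof.
move=> nphi sa a1; set g := a - (3^-1 : R)%:C%:A.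
have sg : star g = g by rewrite (starB HU) (starRZ HU) (star1 HU) sa.
have ga : g * a = a * g.
  by rewrite mulrBl mulrBr -scalerAl -scalerAr mulr1 mul1r.
have h1 := normalized_sqr_ge0 HU nphi sg.
have h2 := normalized_sandwich_ge0 nphi sg sa a1 ga.
have c3 : (3^-1 : R[i]) = (3^-1 : R)%:C by rewrite fmorphV rmorph_nat.
have c4 : (4 / 27 : R[i]) = (4 / 27 : R)%:C by rewrite rmorphM fmorphV !rmorph_nat.
have /(congr1 (fun x => complex.Re (phi x))) := cubic_upper a.
rewrite /= c3 c4 -/g scalarB scalarD !scalarZ nphi.1 !ReD ReN !ReZ (_ : complex.Re 1 = 1)//.
lra.
Qed.

Lemma normalized_cubic_ge phi a : normalized nrm phi -> star a = a -> nrm a <= 1 ->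
  complex.Re (phi (a * (1 - a) ^+ 2)) <= complex.Re (phi a).
Proof.
move=> nphi sa a1; rewrite [X in _ <= complex.Re (phi X)]cubic_lower !scalarD !ReD.
have h1 := normalized_sqr_ge0 HU nphi sa.
have h2 := normalized_sandwich_ge0 nphi sa sa a1 erefl.
lra.
Qed.

(* [2 b = h + i k] with [h], [k] selfadjoint, and [h^2 + k^2 = 2 (b^* b + b b^* )]. *)
Lemma normalized_star_mul_add phi b : normalized nrm phi ->
  0 <= complex.Re (phi (star b * b)) + complex.Re (phi (b * star b)).
Proof.
move=> nphi; pose h := star b + b; pose k := 'i *: (star b - b).
have sh : star h = h by rewrite (uc_starD HU) (uc_starK HU) addrC.
have sk : star k = k.
  by rewrite (uc_starZ HU) (starB HU) (uc_starK HU) conj_i scaleNr -scalerN opprB.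
have h1 := normalized_sqr_ge0 HU nphi sh.
have h2 := normalized_sqr_ge0 HU nphi sk.
have e : h ^+ 2 + k ^+ 2 = (star b * b + b * star b) *+ 2.
  rewrite /k exprZn sqr_i scaleN1r /h !expr2 !mulrDl !mulrDr !mulrN !mulNr !opprD !opprK.
  rewrite mulr2n.
  by rewrite [LHS](AC ((2*2)*(2*2)) ((1*5)*(4*8)*((2*3)*(6*7)))) /= !subrr !add0r.
have := congr1 (fun x => complex.Re (phi x)) e.
rewrite scalarD scalarMn scalarD ReMn !ReD => h3.
by have : 0 <= (complex.Re (phi (star b * b)) + complex.Re (phi (b * star b))) *+ 2;
   [rewrite -h3 addr_ge0 | rewrite pmulrn_lge0].
Qed.

Definition lower_bounded (c : R) :=
  forall phi b, normalized nrm phi -> - (c * nrm b ^+ 2) <= complex.Re (phi (star b * b)).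

(** Both products become cubics thanks to the intertwining
    [b (1 - star b * b) = (1 - b * star b) b]. *)
Let cubic_star b : let c := b * (1 - star b * b) in
  star c * c = star b * b * (1 - star b * b) ^+ 2 /\
  c * star c = b * star b * (1 - b * star b) ^+ 2.
Proof.
set a := star b * b; set a' := b * star b => c.
have sa : star a = a by rewrite (uc_starM HU) (uc_starK HU).
have sc : star c = (1 - a) * star b by rewrite (uc_starM HU) (starB HU) (star1 HU) sa.
have comm : (1 - a) * a = a * (1 - a) by rewrite mulrBl mulrBr mulr1 mul1r.
have inter : b * (1 - a) = (1 - a') * b by rewrite mulrBr mulrBl mulr1 mul1r mulrA.
have inter' : (1 - a) * star b = star b * (1 - a').
  by rewrite mulrBr mulrBl mulr1 mul1r mulrA.
split; rewrite sc.
  by rewrite /c mulrA -[(1 - a) * star b * b]mulrA -/a comm expr2 mulrA.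
have comm' : (1 - a') * a' = a' * (1 - a') by rewrite mulrBl mulrBr mulr1 mul1r.
by rewrite /c inter inter' (mulrA _ _ (1 - a')) -[_ * b * star b]mulrA -/a' comm' expr2 mulrA.
Qed.

Let nrm_star_mul_r b : nrm (b * star b) = nrm b ^+ 2.
Proof. by rewrite -{1}(uc_starK HU b) (uc_nrm_star_mul HU) (nrm_star HU). Qed.

(** The lower bound comes from [normalized_star_mul_add]: [phi (star c * c) >= - phi (c * star c)],
    and [c * star c] is the same cubic in [b * star b]. *)
Let cubic_ge b phi : normalized nrm phi -> nrm b <= 1 -> let c := b * (1 - star b * b) in
  [/\ complex.Re (phi (star c * c)) <= complex.Re (phi (star b * b)),
     complex.Re (phi (star c * c)) <= 4 / 27 & - (4 / 27) <= complex.Re (phi (star c * c))].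
Proof.
move=> nphi b1 c; have [e1 e2] := cubic_star b.
have b21 : nrm b ^+ 2 <= 1 by rewrite expr_le1 ?(nrm_ge0 HU).
have sa : star (star b * b) = star b * b by rewrite (uc_starM HU) (uc_starK HU).
have sa' : star (b * star b) = b * star b by rewrite (uc_starM HU) (uc_starK HU).
have h := normalized_star_mul_add c nphi.
have h' : complex.Re (phi (c * star c)) <= 4 / 27.
  by rewrite e2 normalized_cubic_le// nrm_star_mul_r.
split; last lra.
  by rewrite e1 normalized_cubic_ge// (uc_nrm_star_mul HU).
by rewrite e1 normalized_cubic_le// (uc_nrm_star_mul HU).
Qed.

Let lower_bounded_scale c : (forall phi b, normalized nrm phi -> nrm b <= 1 ->
  - c <= complex.Re (phi (star b * b))) -> lower_bounded c.
Proof.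
(* A vanishing [nrm b] need not mean [b = 0], but the C*-identity then kills [phi (star b * b)]. *)
move=> H phi b nphi; have [b0|b0] : nrm b = 0 \/ 0 < nrm b.
    by have := nrm_ge0 HU b; rewrite le_eqVlt => /orP[/eqP|]; auto.
  have le : rnorm (phi (star b * b)) <= 0.
    by apply: le_trans (nphi.2 _) _; rewrite (uc_nrm_star_mul HU) b0 expr0n.
  have /rnorm0_eq0 -> : rnorm (phi (star b * b)) = 0.
    by apply/eqP; rewrite eq_le le rnorm_ge0.
  by rewrite b0 expr0n mulr0 oppr0.
have := H phi ((nrm b)^-1%:C *: b) nphi.
rewrite (nrmRZ HU) ger0_norm ?invr_ge0 ?(ltW b0)// mulVf ?gt_eqF// => /(_ (lexx _)).
rewrite (starRZ HU) -scalerAl -scalerAr scalerA -rmorphM scalarZ ReZ -expr2 exprVn.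
by rewrite mulrC ler_pdivlMr ?exprn_gt0// mulNr.
Qed.

(* Replacing [b] by [b (1 - b^* b)] decreases [phi (b^* b)] and shrinks [|b|^2]
   to at most [4 / 27], so a lower bound [c] improves to [4 c / 27]. *)
Lemma normalized_star_mul_ge0 phi b : normalized nrm phi ->
  0 <= complex.Re (phi (star b * b)).
Proof.
move=> nphi.
have step c : 0 <= c -> lower_bounded c -> lower_bounded (4 / 27 * c).
  move=> c0 lc; apply: lower_bounded_scale => psi x npsi x1.
  have [h1 _ _] := cubic_ge npsi x1; set y := x * _ in h1.
  (* The norm of [star y * y] is read off a norming functional [chi], for which both bounds by
     [4 / 27] hold. *)
  have ny : nrm y ^+ 2 <= 4 / 27.
    have sy : star (star y * y) = star y * y by rewrite (uc_starM HU) (uc_starK HU).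
    have [chi nchi e] := norming_functional sy.
    have [_ h2 h3] := cubic_ge nchi x1; rewrite -/y in h2 h3.
    by rewrite -(uc_nrm_star_mul HU) -e ler_norml h2 h3.
  by have := lc psi y npsi; nra.
have base : lower_bounded 1.
  move=> psi x npsi; rewrite mul1r lerNl.
  apply: le_trans (_ : rnorm (psi (star x * x)) <= _).
    by rewrite -rnormN -ReN ler_Re.
  by apply: le_trans (npsi.2 _) _; rewrite (uc_nrm_star_mul HU).
have all_n n : lower_bounded ((4 / 27) ^+ n).
  by elim: n => [|n IH]; rewrite ?expr0// exprS; apply: step => //; rewrite exprn_ge0.
rewrite leNgt; apply/negP => neg.
set p := complex.Re _ in neg.
apply: (@unbounded_nat R (nrm b ^+ 2) (- p)) => [|n]; first lra.
have : - p <= (4 / 27) ^+ n * nrm b ^+ 2 by have := all_n n phi b nphi; rewrite -/p; lra.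
have nle : n%:R <= (27 / 4 : R) ^+ n.
  have := @bernoulli_ge R (27 / 4 - 1) n.
  rewrite (_ : 1 + (27 / 4 - 1) = 27 / 4 :> R) => [h|]; last by ring.
  apply: le_trans (h _); last lra.
  have := ler0n R n; lra.
have q0 : 0 <= - p by lra.
move=> /(ler_wpM2l (exprn_ge0 n (_ : 0 <= (27 / 4 : R)))); rewrite mulrA -exprMn.
rewrite (_ : 27 / 4 * (4 / 27) = 1 :> R); last by field.
rewrite expr1n mul1r => h; apply: le_trans (h _); last lra.
exact: ler_wpM2r.
Qed.

End Positivity.

(** * Operator norms and boundedness *)

Section OperatorNorm.
Variables (R : realType) (V W : normedModType R[i]).
Implicit Types (f : V -> W) (x : V).

Lemma norm_le1 (X : normedZmodType R[i]) (x : X) : (`|x| <= 1) = (rnorm x <= 1).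
Proof. by rewrite rnormE -lecR. Qed.

Definition bounded_on_ball f (M : R) := forall x, rnorm x <= 1 -> rnorm (f x) <= M.

Lemma opnorm_le f M : bounded_on_ball f M -> opnorm f <= M.
Proof.
move=> fM; apply: ge_sup.
  by exists (rnorm (f 0)); exists 0 => //=; rewrite normr0 ler01.
by move=> _ [x /= x1 <-]; apply: fM; rewrite -norm_le1.
Qed.

Lemma opnorm_ub f M x : bounded_on_ball f M -> rnorm x <= 1 -> rnorm (f x) <= opnorm f.
Proof.
move=> fM x1; apply: ub_le_sup; last by exists x => //=; rewrite norm_le1.
by exists M => _ [y /= y1 <-]; apply: fM; rewrite -norm_le1.
Qed.

Lemma opnorm_ge0 f M : bounded_on_ball f M -> 0 <= opnorm f.
Proof.
move=> fM; apply: le_trans (rnorm_ge0 (f 0)) _.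
by apply: opnorm_ub fM _; rewrite rnorm0 ler01.
Qed.

Lemma opnorm_bound f M x : bounded_on_ball f M ->
  (forall (t : R) y, f (t%:C *: y) = t%:C *: f y) ->
  rnorm (f x) <= opnorm f * rnorm x.
Proof.
move=> fM fZ; have [->|x0] := eqVneq x 0.
  by have := fZ 0 0; rewrite !scale0r => ->; rewrite !rnorm0 mulr0.
have rx := rnorm_gt0 x0.
have := @opnorm_ub f M ((rnorm x)^-1%:C *: x) fM.
rewrite fZ !rnormZ rnormC ger0_norm ?invr_ge0 ?(ltW rx)// mulVf ?gt_eqF//.
by move=> /(_ (lexx _)); rewrite mulrC ler_pdivrMr.
Qed.

(** An unbounded [f] would have the default supremum 0. This makes states bounded, since their
    [opnorm] is 1. *)
Lemma opnorm_neq0_bounded f : opnorm f != 0 -> exists M, bounded_on_ball f M.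
Proof.
move=> f0; apply: contrapT => unb; move/eqP: f0; apply.
apply: sup_out => -[_ [M ubM]]; apply: unb; exists M => x x1.
by apply: ubM; exists x => //=; rewrite norm_le1.
Qed.

End OperatorNorm.

Lemma state_bound (R : realType) (A : cstarAlgType R) (phi : {scalar A}) a :
  state phi -> rnorm (phi a) <= rnorm a.
Proof.
move=> [_ phi1]; have [|M fM] := @opnorm_neq0_bounded R A R[i]^o phi.
  by rewrite phi1 oner_eq0.
have := @opnorm_bound R A R[i]^o phi M a fM.
by rewrite phi1 mul1r; apply=> t y; rewrite scalarZ.
Qed.

(** * The unitization and the supply of states *)

Section CStarAlgebra.
Variables (R : realType) (A : cstarAlgType R).
Implicit Types (a b x : A).

Lemma cmul0l a : cmul 0 a = 0 :> A.
Proof. by have := cmulZl 0 0 a; rewrite !scale0r. Qed.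

Lemma cmul0r a : cmul a 0 = 0 :> A.
Proof. by have := cmulZr 0 a 0; rewrite !scale0r. Qed.

Lemma rnorm_cmul a b : rnorm (cmul a b) <= rnorm a * rnorm b.
Proof. by rewrite -lecR rmorphM/= -!rnormE norm_cmul_le. Qed.

Lemma rnorm_cstar_cmul a : rnorm (cmul (cstar a) a) = rnorm a ^+ 2.
Proof. by apply: complexI; rewrite rmorphXn/= -!rnormE norm_cstar_cmul. Qed.

Lemma rnorm_cstar a : rnorm (cstar a) = rnorm a.
Proof.
have key b : rnorm b <= rnorm (cstar b).
  have [->|b0] := eqVneq b 0; first by rewrite rnorm0 rnorm_ge0.
  by rewrite -(ler_pM2r (rnorm_gt0 b0)) -expr2 -rnorm_cstar_cmul rnorm_cmul.
by apply/eqP; rewrite eq_le key -{2}(cstarK a) key.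
Qed.

(** The pair [(z, a)] stands for [z + a]. Only the linear structure of the product is inherited;
    multiplication and norm are new. *)
Definition unitization : Type := (R[i]^o * A)%type.

HB.instance Definition _ := GRing.Lmodule.copy unitization (R[i]^o * A)%type.

Implicit Types (u v w : unitization).

Definition uone : unitization := (1, 0).
Definition umul u v : unitization := (u.1 * v.1, u.1 *: v.2 + v.1 *: u.2 + cmul u.2 v.2).

Fact umulA : associative umul.
Proof.
move=> [z a] [w b] [r c]; rewrite /umul/=; congr pair; first exact: mulrA.
rewrite !scalerDr !cmulDl !cmulDr !scalerA !cmulZl !cmulZr cmulA.
by rewrite [r * z]mulrC [r * w]mulrC [LHS](AC ((3*1)*3) ((1*((2*4)*6))*((3*5)*7))).
Qed.

Fact umul1l : left_id uone umul.
Proof. by move=> [z a]; rewrite /umul/= mul1r scale1r scaler0 cmul0l !addr0. Qed.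

Fact umul1r : right_id uone umul.
Proof. by move=> [z a]; rewrite /umul/= mulr1 scale1r scaler0 cmul0r add0r addr0. Qed.

Fact umulDl : left_distributive umul +%R.
Proof.
move=> [z a] [w b] [r c]; rewrite /umul/=; congr pair; first exact: mulrDl.
by rewrite scalerDl scalerDr cmulDl [LHS](AC ((2*2)*2) (((1*3)*5)*((2*4)*6))).
Qed.

Fact umulDr : right_distributive umul +%R.
Proof.
move=> [z a] [w b] [r c]; rewrite /umul/=; congr pair; first exact: mulrDr.
by rewrite scalerDl scalerDr cmulDr [LHS](AC ((2*2)*2) (((1*3)*5)*((2*4)*6))).
Qed.

Fact uone_neq0 : uone != 0.
Proof. by apply/eqP => -[/eqP]; rewrite oner_eq0. Qed.

HB.instance Definition _ := GRing.Zmodule_isNzRing.Build unitization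
  umulA umul1l umul1r umulDl umulDr uone_neq0.

Fact uscaleAl (k : R[i]) u v : k *: (u * v) = (k *: u) * v.
Proof.
case: u v => [z a] [w b]; congr pair; first exact: mulrA.
by rewrite /= !scalerDr !scalerA cmulZl [k * w]mulrC.
Qed.

HB.instance Definition _ := GRing.Lmodule_isLalgebra.Build R[i] unitization uscaleAl.

Fact uscaleAr (k : R[i]) u v : k *: (u * v) = u * (k *: v).
Proof.
case: u v => [z a] [w b]; congr pair; first exact: mulrCA.
by rewrite /= !scalerDr !scalerA cmulZr [k * z]mulrC.
Qed.

HB.instance Definition _ := GRing.Lalgebra_isAlgebra.Build R[i] unitization uscaleAr.

Definition ustar u : unitization := (Num.conj u.1, cstar u.2).

(* [unitization] acts on [A] by left multiplication, and gets the norm of the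
   induced operators. *)
Definition uact u : A -> A := fun x => u.1 *: x + cmul u.2 x.

Definition unrm u : R := opnorm (uact u).

Lemma uactM u v x : uact (u * v) x = uact u (uact v x).
Proof.
case: u v => [z a] [w b]; rewrite /uact/= cmulDr !cmulDl !scalerDr !cmulZl cmulZr scalerA cmulA.
by rewrite -!addrA; congr (_ + _); rewrite addrCA.
Qed.

Lemma uactZ (k : R[i]) u x : uact u (k *: x) = k *: uact u x.
Proof. by rewrite /uact cmulZr scalerDr !scalerA mulrC. Qed.

Lemma uact_bounded u : bounded_on_ball (uact u) (rnorm u.1 + rnorm u.2).
Proof.
move=> x x1; apply: le_trans (rnormD _ _) _; rewrite lerD//.
  by rewrite rnormZ ler_piMr ?rnorm_ge0.
by apply: le_trans (rnorm_cmul _ _) _; rewrite ler_piMr ?rnorm_ge0.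
Qed.

Lemma uact_le u x : rnorm (uact u x) <= unrm u * rnorm x.
Proof. by apply: opnorm_bound (uact_bounded u) _ => t y; rewrite uactZ. Qed.

Lemma unrm_ge0 u : 0 <= unrm u.
Proof. exact: opnorm_ge0 (uact_bounded u). Qed.

(** [ustar u] acts as the adjoint of [u] for the inner product [x^* y] on [A], the source of the
    C*-identity for [unrm]. *)
Lemma cstar_uact u x y : cmul (cstar (uact u x)) y = cmul (cstar x) (uact (ustar u) y).
Proof.
case: u => z a; rewrite /uact/= cstarD cstarZ cstarM cmulDl cmulDr cmulZl cmulZr.
by rewrite cmulA.
Qed.

Lemma unrmM u v : unrm (u * v) <= unrm u * unrm v.
Proof.
apply: opnorm_le => x x1; rewrite uactM; apply: le_trans (uact_le _ _) _.
rewrite ler_wpM2l ?unrm_ge0//; apply: le_trans (uact_le _ _) _.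
by rewrite ler_piMr ?unrm_ge0.
Qed.

Lemma unrm_sqr_le u : unrm u ^+ 2 <= unrm (ustar u * u).
Proof.
have key x : rnorm x <= 1 -> rnorm (uact u x) ^+ 2 <= unrm (ustar u * u).
  move=> x1; rewrite -rnorm_cstar_cmul cstar_uact -uactM.
  apply: le_trans (rnorm_cmul _ _) _; rewrite rnorm_cstar.
  apply: le_trans (_ : 1 * rnorm (uact (ustar u * u) x) <= _).
    by rewrite ler_wpM2r ?rnorm_ge0.
  by rewrite mul1r; apply: le_trans (uact_le _ _) _; rewrite ler_piMr ?unrm_ge0.
have n0 := unrm_ge0 (ustar u * u).
rewrite -[leRHS]sqr_sqrtr// ler_pXn2r ?nnegrE ?unrm_ge0 ?sqrtr_ge0//.
apply: opnorm_le => x x1; rewrite -(@ler_pXn2r _ 2) ?nnegrE ?rnorm_ge0 ?sqrtr_ge0//.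
by rewrite sqr_sqrtr// key.
Qed.

Lemma ustarK : involutive ustar.
Proof. by case=> z a; rewrite /ustar/= conjCK cstarK. Qed.

Lemma unrm_ustar_le u : unrm (ustar u) <= unrm u.
Proof.
have := unrm_sqr_le (ustar u); rewrite ustarK => h.
have := unrm_ge0 (ustar u); rewrite le_eqVlt => /orP[/eqP <-|s0]; first exact: unrm_ge0.
by rewrite -(ler_pM2r s0) -expr2; apply: le_trans h (unrmM _ _).
Qed.

(** The norm is attained along [cstar a], by the C*-identity in [A]. *)
Lemma unrm_inl a : unrm (0, a) = rnorm a.
Proof.
apply/eqP; rewrite eq_le; apply/andP; split.
  by have := opnorm_le (uact_bounded (0, a)); rewrite /= rnorm0 add0r.
have [->|a0] := eqVneq a 0; first by rewrite rnorm0 unrm_ge0.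
have := uact_le (0, a) (cstar a); rewrite /uact/= scale0r add0r rnorm_cstar.
by rewrite -{1}(cstarK a) rnorm_cstar_cmul rnorm_cstar expr2 ler_pM2r// rnorm_gt0.
Qed.

(** A nonzero [a] gives the identity operator of [A] norm 1. If [A] already has a unit, [unrm] is
    only a seminorm. *)
Lemma unitization_cstar a : a != 0 -> unital_cstar ustar unrm.
Proof.
move=> a0; split=> //.
- exact: ustarK.
- by move=> [z b] [w c]; rewrite /ustar/= rmorphD cstarD.
- by move=> k [z b]; rewrite /ustar/= rmorphM cstarZ.
- move=> [z b] [w c]; congr pair; rewrite /= ?rmorphM 1?mulrC//.
  by rewrite !cstarD !cstarZ cstarM [Num.conj z *: _ + _]addrC.
- move=> u v; apply: opnorm_le => x x1.
  have -> : uact (u + v) x = uact u x + uact v x.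
    by rewrite /uact/= scalerDl cmulDl addrACA.
  apply: le_trans (rnormD _ _) _; rewrite lerD//;
  by apply: le_trans (uact_le _ _) _; rewrite ler_piMr ?unrm_ge0.
- move=> k u; have E x : uact (k *: u) x = k *: uact u x.
    by rewrite /uact/= cmulZl scalerDr scalerA.
  apply/eqP; rewrite eq_le; apply/andP; split.
    apply: opnorm_le => x x1; rewrite E rnormZ ler_wpM2l ?rnorm_ge0//.
    by apply: le_trans (uact_le _ _) _; rewrite ler_piMr ?unrm_ge0.
  have [->|k0] := eqVneq k 0; first by rewrite rnorm0 mul0r unrm_ge0.
  rewrite mulrC -ler_pdivlMr ?rnorm_gt0//; apply: opnorm_le => x x1.
  rewrite ler_pdivlMr ?rnorm_gt0// mulrC -rnormZ -E.
  by apply: le_trans (uact_le _ _) _; rewrite ler_piMr ?unrm_ge0.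
- exact: unrmM.
- have E x : uact 1 x = x by rewrite /uact/= scale1r cmul0l addr0.
  apply/eqP; rewrite eq_le; apply/andP; split.
    by apply: opnorm_le => x x1; rewrite E.
  have := uact_le 1 a; rewrite E => h.
  by rewrite -(ler_pM2r (rnorm_gt0 a0)) mul1r.
- move=> u; apply/eqP; rewrite eq_le unrm_sqr_le andbT expr2.
  by apply: le_trans (unrmM _ _) _; rewrite ler_wpM2r ?unrm_ge0 ?unrm_ustar_le.
Qed.

(** A normalized functional of the unitization that norms [(0, b^* b)] is restricted to [A]; the
    value at [b^* b] shows that its norm is still 1. *)
Lemma norming_state b : b != 0 ->
  exists2 phi : {scalar A}, state phi & phi (cmul (cstar b) b) = (rnorm b ^+ 2)%:C.
Proof.
move=> b0; have HU := unitization_cstar b0.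
have mulE x y : ((0, x) : unitization) * (0, y) = (0, cmul x y).
  by congr pair; rewrite /= ?mul0r// !scale0r !add0r.
have starE x : ustar (0, x) = (0, cstar x) by rewrite /ustar/= conjC0.
have sk x : ustar (0, cmul (cstar x) x) = (0, cmul (cstar x) x).
  by rewrite starE cstarM cstarK.
have [psi npsi e] := norming_functional HU (sk b).
pose F (x : A) : R[i] := psi (0, x).
have Flin : GRing.linear_for *%R F.
  move=> c x y; rewrite /F -scalarZ -scalarD; congr (psi _).
  by congr pair; rewrite /= scaler0 addr0.
pose phi : {scalar A} := HB.pack F (GRing.isLinear.Build _ _ _ _ F Flin).
have phiE x : phi x = psi (0, x) by [].
have real x : complex.Im (phi (cmul (cstar x) x)) = 0.
  by rewrite phiE; exact: (normalized_real HU npsi (sk x)).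
have pos x : 0 <= complex.Re (phi (cmul (cstar x) x)).
  by rewrite phiE -mulE -starE; exact: (normalized_star_mul_ge0 HU).
have val : phi (cmul (cstar b) b) = (rnorm b ^+ 2)%:C.
  (* The functional is norming only up to sign; positivity removes the absolute value. *)
  rewrite -rnorm_cstar_cmul -unrm_inl -e ger0_norm; last exact: pos.
  by rewrite [LHS]complexE real rmorph0 mulr0 addr0.
have bnd : @bounded_on_ball R A R[i]^o phi 1.
  by move=> x x1; apply: le_trans x1; rewrite -unrm_inl; exact: npsi.2.
exists phi => //; split.
  by move=> _ [x ->]; rewrite lecE real eqxx/=; exact: pos.
apply/eqP; rewrite eq_le (opnorm_le bnd)/=.
have := @opnorm_bound R A R[i]^o phi 1 (cmul (cstar b) b) bnd.
rewrite val rnormC ger0_norm ?sqr_ge0// rnorm_cstar_cmul.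
move=> /(_ (fun t y => scalarZ phi _ y)) h.
by rewrite -(ler_pM2r (exprn_gt0 2 (rnorm_gt0 b0))) mul1r.
Qed.

End CStarAlgebra.

(** * Hilbert modules and the forms given by states *)

Section HilbertModule.
Variables (R : realType) (A : cstarAlgType R) (E : hilbertModType A).
Implicit Types (x y z : E) (a : A) (T : E -> E) (phi : {scalar A}).

Lemma innerDl x y z : inner (x + y) z = inner x z + inner y z.
Proof. by rewrite -inner_conj innerDr cstarD !inner_conj. Qed.

Lemma innerZl (k : R[i]) x y : inner (k *: x) y = Num.conj k *: inner x y.
Proof. by rewrite -inner_conj innerZr cstarZ inner_conj. Qed.

Lemma inner0r x : inner x 0 = 0 :> A.
Proof. by have := innerZr 0 x 0; rewrite !scale0r. Qed.

Lemma innerNl x y : inner (- x) y = - inner x y.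
Proof. by rewrite -scaleN1r innerZl rmorphN1 scaleN1r. Qed.

Lemma innerNr x y : inner x (- y) = - inner x y.
Proof. by rewrite -scaleN1r innerZr scaleN1r. Qed.

Lemma inner_actl x y a : inner (hact x a) y = cmul (cstar a) (inner x y).
Proof. by rewrite -inner_conj inner_act cstarM inner_conj. Qed.

Lemma inner_ext x y : (forall z, inner x z = inner y z :> A) -> x = y.
Proof.
move=> h; apply/eqP; rewrite -subr_eq0; apply/eqP/inner_def.
by rewrite innerDl innerNl h subrr.
Qed.

(* Were [<x, x>] without a positive square root, [csqrt] would return 0 and
   [norm_hilbert] would force [x = 0], although [<0, 0>] does have a root. *)
Lemma habsP x : cpos (habs x) /\ cmul (habs x) (habs x) = inner x x.
Proof.
pose P := [set b : A | cpos b /\ cmul b b = inner x x].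
have [ex|nex] := pselect (exists b, P b); first exact: (xgetPex 0 ex).
have cs0 : csqrt (inner x x) = 0.
  by apply: xgetPN => b Pb; apply: nex; exists b.
have x0 : x = 0 by apply/eqP; rewrite -normr_eq0 norm_hilbert cs0 normr0.
by case: nex; exists 0; split; [exists 0|]; rewrite ?cmul0r// x0 inner0r.
Qed.

Lemma cstar_cpos a : cpos a -> cstar a = a.
Proof. by move=> [b ->]; rewrite cstarM cstarK. Qed.

Lemma rnorm_inner x : rnorm (inner x x : A) = rnorm x ^+ 2.
Proof.
have [/cstar_cpos hs <-] := habsP x.
rewrite -{1}hs rnorm_cstar_cmul; congr (_ ^+ 2).
by rewrite /rnorm norm_hilbert.
Qed.

Definition qform phi x : R := complex.Re (phi (inner x x)).

Section StateForm.
Variable phi : {scalar A}.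
Hypothesis sphi : state phi.

Lemma qform_ge0 x : 0 <= qform phi x.
Proof. by have := sphi.1 _ (inner_pos x); rewrite lecE => /andP[_]. Qed.

Lemma qformE x : phi (inner x x) = (qform phi x)%:C.
Proof.
have := sphi.1 _ (inner_pos x); rewrite lecE => /andP[/eqP i0 _].
by rewrite [LHS]complexE i0 rmorph0 mulr0 addr0.
Qed.

Lemma qform_le x : qform phi x <= rnorm x ^+ 2.
Proof. by rewrite -rnorm_inner; apply: le_trans (ler_Re _) (state_bound _ sphi). Qed.

(** Polarization: the form is real on the diagonal, in particular at [x + i y]. *)
Lemma phi_inner_sym x y : complex.Re (phi (inner y x)) = complex.Re (phi (inner x y)).
Proof.
have im (u : E) : complex.Im (phi (inner u u)) = 0 by rewrite qformE.
have := im (x + 'i *: y); rewrite innerDl !innerDr innerZl !innerZr innerZl conj_i.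
rewrite !scalarD !scalarZ.
have := im x; have := im y.
case: (phi (inner x x)) => ? ? /=; case: (phi (inner y y)) => ? ? /=.
case: (phi (inner x y)) => ? ? /=; case: (phi (inner y x)) => ? ? /= -> ->; lra.
Qed.

Lemma qformD x y : qform phi (x + y) = qform phi x + qform phi y + 2 * complex.Re (phi (inner x y)).
Proof.
rewrite /qform innerDl !innerDr !scalarD !ReD (phi_inner_sym x y); ring.
Qed.

Lemma qformZ (k : R[i]) x : qform phi (k *: x) = rnorm k ^+ 2 * qform phi x.
Proof. by rewrite /qform innerZl innerZr scalerA conj_mul scalarZ ReZ. Qed.

Lemma form_cauchy_schwarz x y :
  rnorm (phi (inner x y)) ^+ 2 <= qform phi x * qform phi y.
Proof.
have [w w1 <-] := rotate (phi (inner x y)).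
have -> : qform phi y = qform phi (w *: y) by rewrite qformZ w1 expr1n mul1r.
apply: discriminant_le (qform_ge0 x) _ => t.
have := qform_ge0 (t%:C *: x + w *: y).
rewrite qformD qformZ rnormC real_normK ?num_real//.
rewrite innerZl scalarZ (_ : Num.conj t%:C = t%:C); last exact: conjc_real.
by rewrite ReZ innerZr scalarZ; lra.
Qed.

End StateForm.

(** For [d = <x, y>], a state norming [d^* d = <y, x d>] reduces the claim to the scalar inequality:
    [|d|^4 <= phi <y, y> phi <x d, x d> <= |y|^2 |d|^2 |x|^2]. *)
Lemma cauchy_schwarz x y : rnorm (inner x y : A) <= rnorm x * rnorm y.
Proof.
set d : A := inner x y.
have [->|d0] := eqVneq d 0; first by rewrite rnorm0 mulr_ge0 ?rnorm_ge0.
have [phi sphi e] := norming_state d0.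
have dd : cmul (cstar d) d = inner y (hact x d) by rewrite inner_act /d inner_conj.
have := form_cauchy_schwarz sphi y (hact x d).
rewrite -dd e rnormC ger0_norm ?sqr_ge0// => h.
have h2 : qform phi (hact x d) <= rnorm d ^+ 2 * rnorm x ^+ 2.
  apply: le_trans (ler_Re _) _; apply: le_trans (state_bound _ sphi) _.
  rewrite inner_actl inner_act -rnorm_inner.
  apply: le_trans (rnorm_cmul _ _) _; rewrite rnorm_cstar expr2 -mulrA ler_wpM2l ?rnorm_ge0//.
  by apply: le_trans (rnorm_cmul _ _) _; rewrite mulrC.
have h3 := qform_le sphi y.
rewrite -(@ler_pXn2r _ 2) ?nnegrE ?mulr_ge0 ?rnorm_ge0//.
rewrite -(ler_pM2l (exprn_gt0 2 (rnorm_gt0 d0))).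
apply: le_trans (_ : qform phi y * qform phi (hact x d) <= _); first by rewrite -expr2.
apply: le_trans (ler_pM (qform_ge0 sphi _) (qform_ge0 sphi _) h3 h2) _.
by rewrite exprMn mulrCA [_ ^+ 2 * (rnorm x ^+ 2)]mulrC.
Qed.

(** Completeness of [E] gives the limit; [3 / 2] is the sum of the geometric series of ratio
    [1 / 3]. *)
Lemma geometric_cvg (y : nat -> E) :
  (forall n, rnorm (y n.+1 - y n) <= 3^-1 ^+ n) ->
  exists l, forall n, rnorm (l - y n) <= 3 / 2 * 3^-1 ^+ n.
Proof.
move=> step.
have tail n d : rnorm (y (n + d)%N - y n) <= 3 / 2 * (3^-1 ^+ n - 3^-1 ^+ (n + d)).
  elim: d => [|d IH]; first by rewrite addn0 !subrr rnorm0 mulr0.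
  rewrite addnS -[y _.+1](subrK (y (n + d)%N)) -addrA.
  apply: le_trans (rnormD _ _) _.
  apply: le_trans (lerD (step _) IH) _.
  by rewrite exprS; have := exprn_ge0 (n + d) (_ : 0 <= (3^-1 : R)); lra.
have tail' n m : (n <= m)%N -> rnorm (y m - y n) <= 3 / 2 * 3^-1 ^+ n.
  move=> /subnKC <-; apply: le_trans (tail _ _) _.
  rewrite ler_wpM2l//; have := exprn_ge0 (n + (m - n)) (_ : 0 <= (3^-1 : R)); lra.
have small (e : R) : 0 < e -> exists n, 3 / 2 * 3^-1 ^+ n < e.
  move=> e0; apply: contrapT => h.
  apply: (@unbounded_nat R (3 / 2) e) => // n.
  have : e <= 3 / 2 * 3^-1 ^+ n by rewrite leNgt; apply/negP => lt; apply: h; exists n.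
  have n3 : n%:R <= (3 : R) ^+ n by rewrite -natrX ler_nat ltnW// ltn_expl.
  have p3 : (3 : R) ^+ n * 3^-1 ^+ n = 1 by rewrite -exprMn divff ?expr1n// pnatr_eq0.
  move=> /(ler_wpM2l (exprn_ge0 n (_ : 0 <= (3 : R)))) h2.
  apply: le_trans (ler_wpM2r (ltW e0) n3) _.
  by apply: le_trans (h2 _) _; rewrite // mulrCA p3 mulr1.
have cy : cvg (y @ \oo).
  apply: cauchy_cvg; apply: cauchy_exP; move=> e e0.
  have eC : e = (complex.Re e)%:C by rewrite RRe_real// ger0_real// ltW.
  have [n hn] : exists n, 3 / 2 * 3^-1 ^+ n < complex.Re e.
    by apply: small; rewrite -ltcR -eC.
  exists (y n); exists n => // m /= nm.
  rewrite -ball_normE/= eC distrC rnormE ltcR.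
  exact: le_lt_trans (tail' _ _ nm) hn.
exists (lim (y @ \oo)) => n.
apply/ler_addgt0Pr => e e0.
have eC0 : (0 : R[i]) < e%:C by rewrite ltcR.
have /cvgrPdist_lt/(_ _ eC0)[m _ hm] := cy.
have /= := hm (maxn n m) (leq_maxr _ _); rewrite rnormE ltcR => h1.
have h2 := tail' n (maxn n m) (leq_maxl _ _).
rewrite -[lim _](subrK (y (maxn n m))) -addrA.
by apply: le_trans (rnormD _ _) _; lra.
Qed.

(** * Boundedness of adjointable operators *)

Section Adjoint.
Variables (T T' : E -> E).
Hypothesis TT' : forall x y, inner (T x) y = inner x (T' y) :> A.

Lemma adjoint_sym x y : inner (T' x) y = inner x (T y) :> A.
Proof. by rewrite -inner_conj -TT' inner_conj. Qed.

Lemma adjointableZ (k : R[i]) x : T (k *: x) = k *: T x.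
Proof. by apply: inner_ext => z; rewrite TT' !innerZl TT'. Qed.

(* A gliding hump: if [T] were unbounded, the sum of suitably signed small multiples of
   [T u_n] would have an unbounded pairing with [T u_n], that is [<u_n, T' y>]. *)
Lemma adjointable_bounded : exists M, bounded_on_ball T M.
Proof.
apply: contrapT => unb.
(* The growth [4^n] outweighs the sizes [3^-n] of the summands [v n]. *)
have big n : exists u : E, rnorm u <= 1 /\ 4 ^+ n < rnorm (T u).
  apply: contrapT => h; apply: unb; exists (4 ^+ n) => x x1.
  by rewrite leNgt; apply/negP => lt; apply: h; exists x.
have [u hu] := choice big.
have u1 n : rnorm (u n) <= 1 := (hu n).1.
have uT n : 4 ^+ n < rnorm (T (u n)) := (hu n).2.
have T0 n : 0 < rnorm (T (u n)) by apply: le_lt_trans (uT n); rewrite exprn_ge0.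
pose v n := (3^-1 ^+ n / rnorm (T (u n)))%:C *: T (u n).
have vn n : rnorm (v n) = 3^-1 ^+ n.
  by rewrite rnormZ rnormC ger0_norm ?divr_ge0 ?exprn_ge0 ?rnorm_ge0// divfK// gt_eqF.
have pair n : rnorm (inner (T (u n)) (v n) : A) = 3^-1 ^+ n * rnorm (T (u n)).
  rewrite innerZr rnormZ rnorm_inner rnormC ger0_norm ?divr_ge0 ?exprn_ge0 ?rnorm_ge0//.
  by rewrite expr2 mulrA divfK// gt_eqF.
(* Of [y + v n] and [y - v n], one pairs with [T (u n)] at least as strongly as [v n] alone, because
   [|p + q| + |p - q| >= 2 |q|]. *)
pose nxt n y := if rnorm (inner (T (u n)) (v n) : A) <= rnorm (inner (T (u n)) (y + v n) : A)
  then y + v n else y - v n.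
pose y := fix y n := if n is m.+1 then nxt m (y m) else 0.
have step n : rnorm (y n.+1 - y n) <= 3^-1 ^+ n.
  rewrite /= /nxt; case: ifP => _; rewrite addrAC subrr add0r ?rnormN vn//.
have hump n : 3^-1 ^+ n * rnorm (T (u n)) <= rnorm (inner (T (u n)) (y n.+1) : A).
  rewrite -pair /= /nxt; case: ifPn => //; rewrite -ltNge !innerDr innerNr => lt.
  set p : A := inner _ (y n) in lt *; set q : A := inner _ (v n) in lt *.
  have := rnormD (p + q) (- (p - q)); rewrite rnormN.
  have -> : p + q - (p - q) = 2%:C *: q.
    by rewrite opprB addrC addrA subrK -[2]/(1 + 1) rmorphD scalerDl scale1r.
  by rewrite rnormZ rnormC ger0_norm//; lra.
have [l hl] := geometric_cvg step.
(* The tail [|l - y (n + 1)|] is at most [3^-n / 2], so half of the hump survives in the limit. *)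
have lower n : (4 / 3) ^+ n / 2 <= rnorm (T' l).
  apply: le_trans (_ : rnorm (inner (T (u n)) l : A) <= _); last first.
    rewrite TT'; apply: le_trans (cauchy_schwarz _ _) _.
    by rewrite ler_piMl ?rnorm_ge0.
  have h1 := hump n; have h2 := cauchy_schwarz (T (u n)) (y n.+1 - l).
  have h3 : rnorm (T (u n)) * rnorm (y n.+1 - l) <= rnorm (T (u n)) * (2^-1 * 3^-1 ^+ n).
    rewrite ler_wpM2l ?rnorm_ge0// -rnormN opprB; apply: le_trans (hl _) _.
    by rewrite exprS; lra.
  have h4 : rnorm (inner (T (u n)) (y n.+1) : A) <=
      rnorm (inner (T (u n)) l : A) + rnorm (inner (T (u n)) (y n.+1 - l) : A).
    by rewrite -[in leLHS](subrK l (y n.+1)) addrC innerDr rnormD.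
  have h5 : 3^-1 ^+ n * 4 ^+ n <= 3^-1 ^+ n * rnorm (T (u n)).
    by rewrite ler_wpM2l ?exprn_ge0// ltW.
  rewrite exprMn mulrC in h5 *; lra.
apply: (@unbounded_nat R (rnorm (T' l)) (6^-1)) => // n.
apply: le_trans (lower n).
have := @bernoulli_ge R 3^-1 n; rewrite (_ : 1 + 3^-1 = 4 / 3 :> R); last by field.
by move=> h; have := h (_ : 0 <= 3^-1); lra.
Qed.

Lemma adjointable_le x : rnorm (T x) <= opnorm T * rnorm x.
Proof.
have [M bM] := adjointable_bounded.
by apply: opnorm_bound bM _ => t y; rewrite adjointableZ.
Qed.

Lemma adjointable_opnorm_ge0 : 0 <= opnorm T.
Proof. by have [M bM] := adjointable_bounded; exact: opnorm_ge0 bM. Qed.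

Lemma adjoint_le y : rnorm (T' y) <= opnorm T * rnorm y.
Proof.
have [->|t0] := eqVneq (T' y) 0.
  by rewrite rnorm0 mulr_ge0 ?rnorm_ge0 ?adjointable_opnorm_ge0.
rewrite -(ler_pM2l (rnorm_gt0 t0)) -expr2 -rnorm_inner -TT'.
apply: le_trans (cauchy_schwarz _ _) _; rewrite mulrA ler_wpM2r ?rnorm_ge0// mulrC.
exact: adjointable_le.
Qed.

(** [moment_bound] for [G = T' T], symmetric for the form of [phi]: the first moment is
    [phi <T x, T x>] and [|G^n x| <= |T|^(2n) |x|]. *)
Lemma qform_adjointable phi x : state phi ->
  qform phi (T x) <= opnorm T ^+ 2 * qform phi x.
Proof.
move=> sphi; pose G y := T' (T y).
have Gsym y z : inner (G y) z = inner y (G z) :> A by rewrite adjoint_sym TT'.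
have Gn n y z : inner (iter n G y) z = inner y (iter n G z) :> A.
  by elim: n y z => // n IH y z; rewrite iterSr IH Gsym.
pose u n := complex.Re (phi (inner x (iter n G x))).
have K0 := adjointable_opnorm_ge0.
have Gle y : rnorm (G y) <= opnorm T ^+ 2 * rnorm y.
  apply: le_trans (adjoint_le _) _; rewrite expr2 -mulrA ler_wpM2l//.
  exact: adjointable_le.
have Gnle n : rnorm (iter n G x) <= (opnorm T ^+ 2) ^+ n * rnorm x.
  elim: n => [|n IH]; first by rewrite expr0 mul1r.
  rewrite iterS exprS -mulrA; apply: le_trans (Gle _) _.
  by rewrite ler_wpM2l// sqr_ge0.
have cs n : u n ^+ 2 <= u 0%N * u n.*2.
  apply: le_trans (_ : rnorm (phi (inner x (iter n G x))) ^+ 2 <= _).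
    by rewrite sqr_rnorm lerDl sqr_ge0.
  apply: le_trans (form_cauchy_schwarz sphi _ _) _.
  by rewrite /qform Gn -iterD addnn.
have bnd n : `|u n| <= rnorm x ^+ 2 * (opnorm T ^+ 2) ^+ n.
  apply: le_trans (_ : rnorm (phi (inner x (iter n G x))) <= _).
    by rewrite -(@ler_pXn2r _ 2) ?nnegrE ?rnorm_ge0// real_normK ?num_real//
      sqr_rnorm lerDl sqr_ge0.
  apply: le_trans (state_bound _ sphi) _; apply: le_trans (cauchy_schwarz _ _) _.
  by rewrite expr2 -mulrA ler_wpM2l ?rnorm_ge0// mulrC.
have := moment_bound (qform_ge0 sphi x) (sqr_ge0 _) cs bnd.
by apply: le_trans; rewrite /qform TT' ler_norm.
Qed.

End Adjoint.

End HilbertModule.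

(** * Norm additivity and aligned sequences *)

Section NormAdditivity.
Variables (R : realType) (A : cstarAlgType R) (E : hilbertModType A).
Implicit Types (x : E) (phi : {scalar A}).

(** A state norming [|x|] works, as [|x|] is selfadjoint with square [<x, x>]. *)
Lemma norming_vector_state x : x != 0 ->
  exists2 phi, state phi & qform phi x = rnorm x ^+ 2.
Proof.
move=> x0; have [/cstar_cpos hs hx] := habsP x.
have h0 : habs x != 0.
  by apply: contra x0 => /eqP h; apply/eqP/inner_def; rewrite -hx h cmul0r.
have [phi sphi e] := norming_state h0; exists phi => //.
by rewrite /qform -hx -{1}hs e -rnorm_cstar_cmul hs hx rnorm_inner.
Qed.

Variables (s t s' t' : E -> E).
Hypotheses (ss' : forall x y, inner (s x) y = inner x (s' y) :> A)
           (tt' : forall x y, inner (t x) y = inner x (t' y) :> A).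

Let S := opnorm s.
Let T := opnorm t.
Let N := opnorm (s \+ t).

Let st_adj x y : inner ((s \+ t) x) y = inner x ((s' \+ t') y) :> A.
Proof. by rewrite /= innerDl innerDr ss' tt'. Qed.

Let S0 : 0 <= S := adjointable_opnorm_ge0 ss'.
Let T0 : 0 <= T := adjointable_opnorm_ge0 tt'.
Let N0 : 0 <= N := adjointable_opnorm_ge0 st_adj.

Lemma opnormD_le : N <= S + T.
Proof.
have [M bM] := adjointable_bounded ss'; have [M' bM'] := adjointable_bounded tt'.
apply: opnorm_le => x x1 /=; apply: le_trans (rnormD _ _) _.
by rewrite lerD// (opnorm_ub bM, opnorm_ub bM').
Qed.

Let pairing phi x := phi (inner (s x) (t x)).

Let pairing_le phi x : state phi -> qform phi x <= 1 -> rnorm (pairing phi x) <= S * T.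
Proof.
move=> sphi x1; rewrite -(@ler_pXn2r _ 2) ?nnegrE ?rnorm_ge0 ?mulr_ge0//.
apply: le_trans (form_cauchy_schwarz sphi _ _) _.
rewrite exprMn ler_pM ?qform_ge0//.
  by apply: le_trans (qform_adjointable ss' _ sphi) _; rewrite ler_piMr ?sqr_ge0.
by apply: le_trans (qform_adjointable tt' _ sphi) _; rewrite ler_piMr ?sqr_ge0.
Qed.

Let almost_norming (e : R) : (exists x : E, x != 0) -> 0 < e -> e < 1 ->
  exists phi x, [/\ state phi, qform phi x = 1 &
    N ^+ 2 * (1 - e) ^+ 2 <= qform phi ((s \+ t) x)].
Proof.
move=> [x1 x10] e0 e1.
suff [phi [x [sphi m0 h]]] : exists phi x, [/\ state phi, 0 < qform phi x &
    N ^+ 2 * (1 - e) ^+ 2 * qform phi x <= qform phi ((s \+ t) x)].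
  have sm0 : 0 < Num.sqrt (qform phi x) by rewrite sqrtr_gt0.
  exists phi, ((Num.sqrt (qform phi x))^-1%:C *: x); split=> //.
    by rewrite qformZ rnormC ger0_norm ?invr_ge0 ?sqrtr_ge0// exprVn sqr_sqrtr ?ltW// mulVf ?gt_eqF.
  rewrite (adjointableZ st_adj) qformZ rnormC ger0_norm ?invr_ge0 ?sqrtr_ge0//.
  by rewrite exprVn sqr_sqrtr ?(ltW m0)// [leRHS]mulrC ler_pdivlMr.
have [N00|Npos] : N = 0 \/ 0 < N by move: N0; rewrite le_eqVlt => /orP[/eqP|]; auto.
  have [phi sphi e'] := norming_vector_state x10; exists phi, x1; split=> //.
    by rewrite e' exprn_gt0// rnorm_gt0.
  by rewrite N00 expr0n !mul0r qform_ge0.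
have [x [xle xN]] : exists x, rnorm x <= 1 /\ N * (1 - e) < rnorm ((s \+ t) x).
  apply: contrapT => h.
  have : N <= N * (1 - e).
    apply: opnorm_le => x xle; rewrite leNgt; apply/negP => lt.
    by apply: h; exists x.
  by nra.
have Ne : 0 <= N * (1 - e) by rewrite mulr_ge0// subr_ge0 ltW.
have y0 : (s \+ t) x != 0.
  by apply/negP => /eqP h; move: xN; rewrite h rnorm0 ltNge Ne.
have [phi sphi e'] := norming_vector_state y0.
have lb : N ^+ 2 * (1 - e) ^+ 2 <= qform phi ((s \+ t) x).
  by rewrite e' -exprMn ler_pXn2r ?nnegrE ?rnorm_ge0// ltW.
have m1 : qform phi x <= 1.
  by apply: le_trans (qform_le sphi _) _; rewrite expr_le1 ?rnorm_ge0.
exists phi, x; split=> //.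
  (* If [qform phi x] were 0, so would be its value at [(s + t) x], which is [|(s + t) x|^2]. *)
  have := qform_adjointable st_adj x sphi; rewrite e' => h.
  rewrite lt_neqAle qform_ge0// andbT eq_sym; apply/negP => /eqP m0.
  move: h; rewrite m0 mulr0 => h.
  by have := exprn_gt0 2 (rnorm_gt0 y0); rewrite ltNge h.
apply: le_trans lb; rewrite ler_piMr// mulr_ge0 ?sqr_ge0//.
Qed.

Let almost_aligned (d : R) : (exists x : E, x != 0) -> N = S + T -> 0 < d ->
  exists phi x, [/\ state phi, qform phi x = 1 & rnorm (pairing phi x - (S * T)%:C) < d].
Proof.
move=> E0 NST d0.
(* The squared distance from the pairing to [S T] will be at most [2 S T (S + T)^2 e = e C - e]; the
   summand 1 makes this strictly less than [d^2]. *)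
pose C := S * T * (S + T) ^+ 2 * 2 + 1.
have C0 : 0 < C.
  have : 0 <= S * T * (S + T) ^+ 2 by rewrite mulr_ge0 ?sqr_ge0 ?mulr_ge0.
  by rewrite /C; lra.
pose e := Num.min (2^-1) (d ^+ 2 / C).
have e0 : 0 < e by rewrite lt_min invr_gt0 ltr0n divr_gt0// exprn_gt0.
have e2 : e <= 2^-1 by rewrite ge_min lexx.
have eC : e * C <= d ^+ 2 by rewrite -ler_pdivlMr// ge_min lexx orbT.
have [|phi [x [sphi x1 h]]] := almost_norming E0 e0; first lra.
exists phi, x; split=> //.
have ub : rnorm (pairing phi x) <= S * T by apply: pairing_le; rewrite ?x1.
have := h; rewrite (qformD sphi) NST => h1.
have us := qform_adjointable ss' x sphi; have ut := qform_adjointable tt' x sphi.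
rewrite x1 mulr1 -/S in us; rewrite x1 mulr1 -/T in ut.
rewrite -/(pairing phi x) in h1.
have w1 : S * T - (S + T) ^+ 2 * e <= complex.Re (pairing phi x).
  have : 0 <= (S + T) ^+ 2 * e ^+ 2 by rewrite mulr_ge0 ?sqr_ge0.
  nra.
rewrite -(@ltr_pXn2r _ 2) ?nnegrE ?rnorm_ge0 ?(ltW d0)//.
have -> : rnorm (pairing phi x - (S * T)%:C) ^+ 2 =
    rnorm (pairing phi x) ^+ 2 - 2 * (S * T) * complex.Re (pairing phi x) + (S * T) ^+ 2.
  by rewrite !sqr_rnorm; case: (pairing phi x) => a b /=; ring.
have ub2 : rnorm (pairing phi x) ^+ 2 <= (S * T) ^+ 2.
  by rewrite ler_pXn2r ?nnegrE ?rnorm_ge0 ?mulr_ge0.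
have := ler_wpM2l (mulr_ge0 S0 T0) w1.
have : e * C = S * T * ((S + T) ^+ 2 * e) * 2 + e by rewrite /C; ring.
lra.
Qed.

Lemma aligned_sequences : (exists x : E, x != 0) -> N = S + T ->
  exists (phi : nat -> {scalar A}) (x : nat -> E),
    [/\ forall n, state (phi n), forall n, qform (phi n) (x n) = 1
      & (pairing (phi n) (x n) : R[i]^o) @[n --> \oo] --> ((S * T)%:C : R[i]^o)].
Proof.
move=> E0 NST.
have H (n : nat) : exists p : {scalar A} * E, [/\ state p.1, qform p.1 p.2 = 1 &
    rnorm (pairing p.1 p.2 - (S * T)%:C) < n.+1%:R^-1].
  have [|phi [x h]] := almost_aligned (d := n.+1%:R^-1) E0 NST.
    by rewrite invr_gt0 ltr0n.
  by exists (phi, x).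
have [p Hp] := choice H.
exists (fun n => (p n).1), (fun n => (p n).2); split.
- by move=> n; have [] := Hp n.
- by move=> n; have [] := Hp n.
apply/cvgrPdist_lt => e e0.
have eC : e = (complex.Re e)%:C by rewrite RRe_real// ger0_real// ltW.
have re0 : 0 < complex.Re e by rewrite -ltcR -eC.
exists (Num.Def.archi_bound (complex.Re e)^-1) => // n /= bn.
rewrite distrC rnormE eC ltcR; have [_ _ h] := Hp n.
apply: lt_trans h _; rewrite invf_plt ?posrE ?ltr0n//.
have := archi_boundP (ltW (_ : 0 < (complex.Re e)^-1)); rewrite invr_gt0 => /(_ re0) h.
by apply: lt_le_trans h _; rewrite ler_nat ltnW.
Qed.

(** By Cauchy-Schwarz a pairing close to [S T] forces [phi <s x, s x>] and [phi <t x, t x>] close to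
    [S^2] and [T^2]; expanding [phi <(s + t) x, (s + t) x>] then gives nearly [(S + T)^2]. *)
Lemma opnormD_of_aligned (phi : nat -> {scalar A}) (x : nat -> E) :
  (forall n, state (phi n)) -> (forall n, qform (phi n) (x n) <= 1) ->
  (pairing (phi n) (x n) : R[i]^o) @[n --> \oo] --> ((S * T)%:C : R[i]^o) ->
  N = S + T.
Proof.
move=> sphi x1 cv.
have zero (f f' : E -> E) : (forall x y, inner (f x) y = inner x (f' y) :> A) ->
    opnorm f = 0 -> forall y, f y = 0.
  move=> ff' f0 y; apply: rnorm0_eq0; apply/eqP; rewrite eq_le rnorm_ge0 andbT.
  by have := adjointable_le ff' y; rewrite f0 mul0r.
have [Sz|Spos] : S = 0 \/ 0 < S by move: S0; rewrite le_eqVlt => /orP[/eqP|]; auto.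
  rewrite Sz add0r /N (_ : s \+ t = t)//; apply/funext => y /=.
  by rewrite (zero _ _ ss' Sz) add0r.
have [Tz|Tpos] : T = 0 \/ 0 < T by move: T0; rewrite le_eqVlt => /orP[/eqP|]; auto.
  rewrite Tz addr0 /N (_ : s \+ t = s)//; apply/funext => y /=.
  by rewrite (zero _ _ tt' Tz) addr0.
apply/eqP; rewrite eq_le opnormD_le/=.
rewrite -(@ler_pXn2r _ 2) ?nnegrE ?addr_ge0//.
(* The three summands are the losses in [u], [v] and [2 Re z]; [e <= S T] allows squaring
   [S T - e]. *)
apply: (@le_of_le_add_small R _ _ (2 * S / T + 2 * T / S + 2) (S * T)); first exact: mulr_gt0.
move=> e e0 eST.
have eC0 : (0 : R[i]) < e%:C by rewrite ltcR.
have /cvgrPdist_lt/(_ _ eC0)[n _ /(_ n (leqnn n))/=] := cv.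
rewrite distrC rnormE ltcR => h.
set z := pairing _ _ in h; set u := qform (phi n) (s (x n)); set v := qform (phi n) (t (x n)).
have wge : S * T - e <= complex.Re z.
  have := ler_Re (- (z - (S * T)%:C)); rewrite rnormN ReN ReD ReN /=; lra.
have us : u <= S ^+ 2.
  by apply: le_trans (qform_adjointable ss' _ (sphi n)) _; rewrite ler_piMr ?sqr_ge0.
have vt : v <= T ^+ 2.
  by apply: le_trans (qform_adjointable tt' _ (sphi n)) _; rewrite ler_piMr ?sqr_ge0.
have u0 : 0 <= u := qform_ge0 (sphi n) _.
have v0 : 0 <= v := qform_ge0 (sphi n) _.
have uv : (S * T - e) ^+ 2 <= u * v.
  apply: le_trans (_ : complex.Re z ^+ 2 <= _).
    by rewrite ler_pXn2r ?nnegrE//; lra.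
  apply: le_trans (form_cauchy_schwarz (sphi n) _ _).
  by rewrite sqr_rnorm lerDl sqr_ge0.
have tot : u + v + 2 * complex.Re z <= N ^+ 2.
  rewrite /u /v /z -(qformD (sphi n)).
  by apply: le_trans (qform_adjointable st_adj _ (sphi n)) _; rewrite ler_piMr ?sqr_ge0.
have u1 : S ^+ 2 - 2 * S / T * e <= u.
  rewrite -(ler_pM2r (exprn_gt0 2 Tpos)).
  rewrite (_ : _ * T ^+ 2 = (S * T) ^+ 2 - 2 * (S * T) * e); last by field; rewrite gt_eqF.
  by have := ler_wpM2l u0 vt; have := sqr_ge0 e; lra.
have v1 : T ^+ 2 - 2 * T / S * e <= v.
  rewrite -(ler_pM2r (exprn_gt0 2 Spos)).
  rewrite (_ : _ * S ^+ 2 = (S * T) ^+ 2 - 2 * (S * T) * e); last by field; rewrite gt_eqF.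
  by have := ler_wpM2r v0 us; have := sqr_ge0 e; lra.
lra.
Qed.

End NormAdditivity.

Theorem theorem2p7 (R : realType) (A : cstarAlgType R) (E : hilbertModType A)
    (E_neq0 : exists x : E, x != 0)
    (s t : E -> E) (s_adj : adjointable s) (t_adj : adjointable t) :
  [<-> opnorm (s \+ t) = opnorm s + opnorm t ;
       exists (phi : nat -> {scalar A}) (x : nat -> E),
         [/\ forall n, state (phi n),
             forall n, phi n (cmul (habs (x n)) (habs (x n))) = 1
           & (phi n (inner (s (x n)) (t (x n))) : R[i]^o) @[n --> \oo]
               --> ((opnorm s * opnorm t)%:C : R[i]^o)] ;
       exists (phi : nat -> {scalar A}) (x : nat -> E),
         [/\ forall n, state (phi n),
             forall n, phi n (cmul (habs (x n)) (habs (x n))) <= 1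
           & (phi n (inner (s (x n)) (t (x n))) : R[i]^o) @[n --> \oo]
               --> ((opnorm s * opnorm t)%:C : R[i]^o)] ].
Proof.
have [s' ss'] := s_adj; have [t' tt'] := t_adj.
tfae.
- move=> eqN; have [phi [x [sphi x1 cv]]] := aligned_sequences ss' tt' E_neq0 eqN.
  exists phi, x; split=> // n.
  by rewrite (habsP (x n)).2 qformE// x1.
- move=> [phi [x [sphi x1 cv]]]; exists phi, x; split=> // n.
  by rewrite x1.
- move=> [phi [x [sphi x1 cv]]]; apply: (opnormD_of_aligned ss' tt' sphi _ cv) => n.
  by have := x1 n; rewrite (habsP (x n)).2 qformE// -lecR.
Qed.
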